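(* (1) The following are equivalent: (a) $\mathrm{SCP}$. (b) Every $*$-operationally closed poset is $\omega_2$-strategically closed. (c) $\mathbb{P}_{\mathrm{SCP}}$ is $\omega_2$-strategically closed. (d) $\mathrm{MA}_{\omega_2}(\text{$*$-operationally closed})$. (e) $\mathrm{MA}_{\omega_2}(\mathbb{P}_{\mathrm{SCP}})$. (2) The following are equivalent: (a) $\mathrm{SCP}^-$. (b) Every $*$-tactically closed poset is $\omega_2$-strategically closed. (c) $\mathbb{P}_{\mathrm{SCP}^-}$ is $\omega_2$-strategically closed. (d) $\mathrm{MA}_{\omega_2}(\text{$*$-tactically closed})$. (e) $\mathrm{MA}_{\omega_2}(\mathbb{P}_{\mathrm{SCP}^-})$.
   Context: Posets $\mathbb{P}$ are reflexive, transitive and separative (not necessarily antisymmetric), with a specified greatest element $1_{\mathbb{P}}$; smaller conditions are stronger. $\mathcal{B}(\mathbb{P})$ is the Boolean completion, and $\bigwedge A$ is computed in $\mathcal{B}(\mathbb{P})$. $\mathrm{Lim}$ is the class of nonzero limit ordinals. $S^2_i=\{\alpha<\omega_2\mid\mathrm{cf}\,\alpha=\omega_i\}$ for $i=0,1$; o.t. denotes order type. $\mathrm{MA}_{\omega_2}(\Gamma)$, for a class $\Gamma$ of posets (or a single poset), says: for every $\mathbb{P}\in\Gamma$ and every family of at most $\aleph_2$ dense subsets of $\mathbb{P}$ there is a filter on $\mathbb{P}$ meeting all of them. Strategic closedness. In the game $G_\alpha(\mathbb{P})$ Players I and II alternately choose conditions, each move being stronger than (i.e. $\le$) all preceding moves;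 turns are indexed by ordinals $\gamma<\alpha$; at turn $\gamma=0$ or $\gamma$ successor I plays $a_\gamma$ and then II plays $b_\gamma$, while at limit turns $\gamma$ I skips and II plays $b_\gamma$. II wins if she is able to take her turns $\alpha$ times without getting stuck. A strategy for II gives her move as a function of the sequence of preceding moves of I. $\mathbb{P}$ is $\alpha$-strategically closed if II has a winning strategy in $G_\alpha(\mathbb{P})$. The game $G^*(\mathbb{P})$: At each turn $\gamma\in\omega_1\setminus\mathrm{Lim}$ Player I plays a nonempty countable set $A_\gamma\subseteq\mathbb{P}$, and then II plays $b_\gamma\in\mathbb{P}$; at turns $\gamma\in\omega_1\cap\mathrm{Lim}$ Player I skips and II plays $b_\gamma\in\mathbb{P}$. For limit $\gamma$ put $A_\gamma=\bigcup\{A_\xi\mid \xi\in\gamma\setminus\mathrm{Lim}\}$. Player I must ensure: $\langle A_\gamma\mid\gamma\in\omega_1\setminus\mathrm{Lim}\rangle$ is $\subseteq$-increasing; each $A_\gamma$ ($\gamma\in\omega_1\setminus\mathrm{Lim}$) has a common extension in $\mathbb{P}$; and $\bigwedge A_{\gamma+1}\le_{\mathcal{B}(\mathbb{P})}b_\gamma$ for each $\gamma<\omega_1$. Player II must ensure that $b_\gamma$ is a common extension of $A_\gamma$ for every $\gamma<\omega_1$. Player II wins if she is able to make all her moves up to and including her $\omega_1$-th move (i.e. she never gets stuck, and finally $\bigcup\{A_\xi\mid\xi\in\omega_1\setminus\mathrm{Lim}\}$ has a common extension). $[\mathbb{P}]^{\le\aleph_0}_+$ is the set of nonempty countable $A\subseteq\mathbb{P}$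 having a common extension in $\mathbb{P}$. A $*$-operation is a function $\tau:\omega_1\times[\mathbb{P}]^{\le\aleph_0}_+\to\mathbb{P}$; II plays according to $\tau$ if for each $\delta<\omega_1$ she chooses $\tau(\delta,A_\delta)$ as her $\delta$-th move as long as it is legal (an illegal prescription counts as a loss for her); $\tau$ is winning if II wins every play in which she plays according to $\tau$. A $*$-tactic is a $*$-operation whose values do not depend on the first argument. $\mathbb{P}$ is $*$-operationally (resp. $*$-tactically) closed if there is a winning $*$-operation (resp. $*$-tactic) for $G^*(\mathbb{P})$. $\mathrm{SCP}$: there exist a sequence $\langle z_\alpha\mid\alpha\in S^2_0\rangle$ and a function $f:\omega_2\to\omega_1$ such that each $z_\alpha$ is a countable cofinal subset of $\alpha$ and, for each $\beta\in S^2_1$, there is a club subset $C$ of $\beta\cap S^2_0$ (i.e. $C\subseteq S^2_0$ is closed unbounded in $\beta$) with $\mathrm{o.t.}\,C=\omega_1$ such that (i) $\langle z_\alpha\mid\alpha\in C\rangle$ is increasing and continuous with respect to inclusion, and (ii) $f(\alpha)=\mathrm{o.t.}(C\cap\alpha)$ for each $\alpha\in C$. $\mathrm{SCP}^-$ is the statement obtained by removing all references to $f$ (in particular (ii)). $\mathbb{P}_{\mathrm{SCP}}$: conditions (besides a greatest, empty condition) are $p=\langle\langle z^p_\alpha\mid\alpha\in S^2_0,\ \alpha\le\beta^p\rangle,f^p\rangle$ where $\beta^p\in S^2_0$; $f^p:\beta^p+1\to\omega_1$; each $z^p_\alpha$ is a countable cofinal subset of $\alpha$; and for each $\beta\in\beta^p\cap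 S^2_1$ there is a club subset $C$ of $\beta\cap S^2_0$ with $\mathrm{o.t.}\,C=\omega_1$ such that $\langle z^p_\alpha\mid\alpha\in C\rangle$ is increasing and continuous with respect to inclusion and $f^p(\alpha)=\mathrm{o.t.}(C\cap\alpha)$ for each $\alpha\in C$. $p\le q$ iff $p$ end-extends $q$: $\vec z^{\,q}=\vec z^{\,p}\restriction(\beta^q+1)$ and $f^q=f^p\restriction(\beta^q+1)$. $\mathbb{P}_{\mathrm{SCP}^-}$ is defined in the same way with $f^p$ and all requirements about it removed, ordered by end-extension. *)

(* Defs.v *)
From mathcomp Require Import all_boot all_order.
From mathcomp Require Import boolp classical_sets functions cardinality wochoice.

Set Implicit Arguments.
Unset Strict Implicit.
Unset Printing Implicit Defensive.

Local Open Scope order_scope.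
Local Open Scope classical_set_scope.
Local Open Scope card_scope.

(* An ordinal is represented by a well-ordered type, and its elements stand
   for the smaller ordinals.  The next two predicates characterize omega_1 and
   omega_2 up to a unique isomorphism. *)
Definition is_omega1 d (W1 : orderType d) : Prop :=
  [/\ well_order (<=%O : rel W1),
      ~ countable [set: W1]
    & forall a : W1, countable [set b : W1 | b < a]].

Definition is_omega2 d1 (W1 : orderType d1) d2 (W2 : orderType d2) : Prop :=
  [/\ well_order (<=%O : rel W2),
      ~ ([set: W2] #<= [set: W1])
    & forall a : W2, [set b : W2 | b < a] #<= [set: W1]].

Section Ordinals.
Context {d : Order.disp_t} {W : orderType d}.
Implicit Types (a b : W) (A C : set W).

Definition below a : set W := [set b | b < a].

(* nonzero limit ordinals *)
Definition is_limit a : Prop :=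
  (exists b, b < a) /\ (forall b, b < a -> exists c, b < c /\ c < a).

(* b = a + 1 *)
Definition is_succ a b : Prop := a < b /\ forall c, c < b -> c <= a.

Definition cofinal_in A a : Prop :=
  A `<=` below a /\ forall b, b < a -> exists2 c, A c & b <= c.

(* cf a = |K|: the least cardinality of a cofinal subset of a is that of K *)
Definition has_cf T (a : W) (K : set T) : Prop :=
  (exists2 A, cofinal_in A a & A #= K) /\
  (forall A, cofinal_in A a -> K #<= A).

Definition limit_point C a : Prop :=
  is_limit a /\ forall b, b < a -> exists c, [/\ C c, b < c & c < a].

Definition club_in C a : Prop :=
  cofinal_in C a /\ (forall b, b < a -> limit_point C b -> C b).

(* At the places of C which are not limit points of C, continuity imposes
   nothing; C is closed wherever this is used, so the limit places of the
   increasing enumeration of C are exactly its members which are limit points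
   of C. *)
Definition increasing_continuous_on T C (z : W -> set T) : Prop :=
  (forall a b, C a -> C b -> a <= b -> z a `<=` z b) /\
  (forall a, C a -> limit_point C a ->
     z a = \bigcup_(b in C `&` below a) z b).

End Ordinals.

Definition same_order_type d (W : orderType d) d' (W' : orderType d')
    (A : set W) (B : set W') : Prop :=
  exists g : W -> W',
    (forall x y, A x -> A y -> (x < y) = (g x < g y)) /\ g @` A = B.

Section SquareLike.
Context {d1 d2 : Order.disp_t} (W1 : orderType d1) (W2 : orderType d2).
Implicit Types (a b : W2) (z : W2 -> set W2) (f : W2 -> W1).

Definition S20 : set W2 := [set a | has_cf a [set: nat]].
Definition S21 : set W2 := [set a | has_cf a [set: W1]].

Definition countable_cofinal (A : set W2) a : Prop :=
  countable A /\ cofinal_in A a.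

Definition climbing_club z b (C : set W2) : Prop :=
  [/\ C `<=` S20, club_in C b, same_order_type [set: W1] C
    & increasing_continuous_on C z].

(* f a = o.t.(C `&` a) for every a in C *)
Definition counts_club f (C : set W2) : Prop :=
  forall a, C a -> same_order_type (below (f a)) (C `&` below a).

Definition SCP : Prop :=
  exists z f, (forall a, S20 a -> countable_cofinal (z a) a) /\
    (forall b, S21 b -> exists2 C, climbing_club z b C & counts_club f C).

Definition SCPm : Prop :=
  exists z, (forall a, S20 a -> countable_cofinal (z a) a) /\
    (forall b, S21 b -> exists C, climbing_club z b C).

End SquareLike.

(* Separativity is kept as a separate predicate, so that concrete posets can be
   named without proving it first. *)
Record poset := Poset {
  pcarrier :> Type;
  ple : pcarrier -> pcarrier -> Prop;
  pone : pcarrier;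
  ple_refl : forall p, ple p p;
  ple_trans : forall p q r, ple p q -> ple q r -> ple p r;
  ple_one : forall p, ple p pone
}.
Arguments ple {_} _ _.
Arguments pone {_}.

Section Forcing.
Variable P : poset.
Implicit Types (p q r : P) (A D F : set P).

Definition compatible p q : Prop := exists r, ple r p /\ ple r q.

Definition separative : Prop :=
  forall p q, ~ ple p q -> exists r, ple r p /\ ~ compatible r q.

Definition common_extension A p : Prop := forall a, A a -> ple p a.

Definition dense D : Prop := forall p, exists2 q, D q & ple q p.

Definition poset_filter F : Prop :=
  [/\ F !=set0,
      forall p q, F p -> ple p q -> F q
    & forall p q, F p -> F q -> exists r, [/\ F r, ple r p & ple r q]].

(* MA for the single poset P and families of at most |W| dense sets *)
Definition MA d (W : orderType d) : Prop :=
  forall DD : set (set P),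
    DD #<= [set: W] -> (forall D, DD D -> dense D) ->
    exists2 F, poset_filter F & forall D, DD D -> D `&` F !=set0.

(* The Boolean completion, as the algebra of regular open subsets of P. *)
Definition regular_open (U : set P) : Prop :=
  (forall p q, U p -> ple q p -> U q) /\
  (forall p, (forall q, ple q p -> exists2 r, ple r q & U r) -> U p).

Record bcompl := BCompl { bc_set :> set P; bc_regular : regular_open bc_set }.

Definition bc_le (U V : bcompl) : Prop := U `<=` V.

Lemma regular_open_embed p :
  regular_open [set q | forall r, ple r q -> compatible r p].
Proof.
split=> [q r qP rq s sr|q qP r rq]; first exact: qP (ple_trans sr rq).
have [s sr sP] := qP r rq.
have [t [ts tp]] := sP s (ple_refl s).
by exists t; split => //; exact: ple_trans ts sr.
Qed.

Definition bc_embed p : bcompl := BCompl (regular_open_embed p).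

Lemma regular_open_inf (B : set bcompl) :
  regular_open (\bigcap_(U in B) bc_set U).
Proof.
split=> [p q pB qp U BU|p pB U BU].
  exact: (bc_regular U).1 (pB U BU) qp.
apply: (bc_regular U).2 => q /pB[r rq rB].
by exists r => //; exact: rB.
Qed.

Definition bc_inf (B : set bcompl) : bcompl := BCompl (regular_open_inf B).

Lemma bc_infP (B : set bcompl) (V : bcompl) :
  bc_le V (bc_inf B) <-> forall U, B U -> bc_le V U.
Proof.
split=> [VB U BU p /VB pB|VB p Vp U BU]; first exact: pB.
exact: VB BU p Vp.
Qed.

Lemma bc_embedP p q : separative -> bc_le (bc_embed p) (bc_embed q) <-> ple p q.
Proof.
move=> sep; split=> [pq|pq r rp s sr].
  apply: contrapT => /sep[r [rp rq]]; apply: rq.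
  apply: (pq r _ r (ple_refl r)) => s sr.
  by exists s; split; [exact: ple_refl | exact: ple_trans sr rp].
have [t [ts tp]] := rp s sr.
by exists t; split => //; exact: ple_trans tp pq.
Qed.

(* the game G_alpha(P), where alpha is the order type of W *)
Section StrategicClosure.
Context {d : Order.disp_t} (W : orderType d).
Implicit Types (c : W) (a b : W -> P).

(* A sequence of moves of Player I is a total function on W whose values at
   limit turns are never used.  A strategy sees the moves of I up to and
   including the current turn, and nothing else. *)
Definition is_strategy (s : W -> (W -> P) -> P) : Prop :=
  forall c a a',
    (forall e, e <= c -> ~ is_limit e -> a e = a' e) -> s c a = s c a'.

Definition I_legal a b c : Prop :=
  forall e, e < c -> (~ is_limit e -> ple (a c) (a e)) /\ ple (a c) (b e).

Definition II_legal a b c : Prop :=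
  (forall e, e <= c -> ~ is_limit e -> ple (b c) (a e)) /\
  (forall e, e < c -> ple (b c) (b e)).

Definition winning_strategy (s : W -> (W -> P) -> P) : Prop :=
  forall a, let b := s^~ a in
    forall c, (forall e, e <= c -> ~ is_limit e -> I_legal a b e) ->
    II_legal a b c.

Definition strategically_closed : Prop :=
  exists2 s, is_strategy s & winning_strategy s.

End StrategicClosure.

Section StarGame.
Context {d : Order.disp_t} (W1 : orderType d).
Implicit Types (c : W1) (B : W1 -> set P) (b : W1 -> P).

(* [P]^{<= aleph_0}_+ *)
Definition countable_plus A : Prop :=
  [/\ A !=set0, countable A & exists p, common_extension A p].

(* The sets A_c of the game: I's move itself unless c is a limit, the union of
   his earlier moves if c is a limit. *)
Definition star_set B c : set P :=
  if `[< is_limit c >] then \bigcup_(e in [set e | e < c /\ ~ is_limit e]) B e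
  else B c.

Definition star_I_legal B b c : Prop :=
  [/\ countable_plus (B c),
      forall e, e < c -> ~ is_limit e -> B e `<=` B c
    & forall e, is_succ e c ->
        bc_le (bc_inf [set bc_embed p | p in B c]) (bc_embed (b e))].

(* The values of a star-operation outside [P]^{<= aleph_0}_+ are irrelevant:
   in a play which I has followed legally, A_c fails to lie there only if it
   has no common extension, and then no move of II is legal. *)
Definition star_operation : Type := W1 -> set P -> P.

Definition star_winning (t : star_operation) : Prop :=
  forall B, let b := fun c => t c (star_set B c) in
    (forall c, (forall e, e <= c -> ~ is_limit e -> star_I_legal B b e) ->
       common_extension (star_set B c) (b c)) /\
    ((forall e, ~ is_limit e -> star_I_legal B b e) ->
       exists p, common_extension (\bigcup_(e in [set e | ~ is_limit e]) B e) p).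

Definition star_tactic (t : star_operation) : Prop :=
  forall c c' A, countable_plus A -> t c A = t c' A.

Definition star_operationally_closed : Prop :=
  exists t, star_winning t.

Definition star_tactically_closed : Prop :=
  exists2 t, star_tactic t & star_winning t.

End StarGame.
End Forcing.

Arguments MA P {d} W.
Arguments strategically_closed P {d} W.
Arguments star_operationally_closed P {d} W1.
Arguments star_tactically_closed P {d} W1.

Section ForcingSCP.
Context {d1 d2 : Order.disp_t} (W1 : orderType d1) (W2 : orderType d2).

(* The sequences of a condition are extended by 0 (that is, by the empty set,
   resp. by the least element of W1) outside of their domain, so that total
   functions represent them faithfully. *)
Record cond_SCPm := CondSCPm {
  cm_top : W2;
  cm_z : W2 -> set W2;
  cm_top_S20 : S20 cm_top;
  cm_z_dom : forall a, ~ (S20 a /\ a <= cm_top) -> cm_z a = set0;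
  cm_z_cofinal : forall a, S20 a -> a <= cm_top -> countable_cofinal (cm_z a) a;
  cm_club : forall b, S21 W1 b -> b < cm_top ->
    exists C, climbing_club W1 cm_z b C
}.

Record cond_SCP := CondSCP {
  c_top : W2;
  c_z : W2 -> set W2;
  c_f : W2 -> W1;
  c_top_S20 : S20 c_top;
  c_z_dom : forall a, ~ (S20 a /\ a <= c_top) -> c_z a = set0;
  c_f_dom : forall a, ~ (a <= c_top) -> forall x : W1, c_f a <= x;
  c_z_cofinal : forall a, S20 a -> a <= c_top -> countable_cofinal (c_z a) a;
  c_club : forall b, S21 W1 b -> b < c_top ->
    exists2 C, climbing_club W1 c_z b C & counts_club c_f C
}.

Definition end_extends_SCPm (p q : cond_SCPm) : Prop :=
  cm_top q <= cm_top p /\ forall a, a <= cm_top q -> cm_z q a = cm_z p a.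

Definition end_extends_SCP (p q : cond_SCP) : Prop :=
  c_top q <= c_top p /\
  forall a, a <= c_top q -> c_z q a = c_z p a /\ c_f q a = c_f p a.

(* [None] is the empty condition. *)
Definition with_top T (R : T -> T -> Prop) (p q : option T) : Prop :=
  match p, q with
  | _, None => True
  | None, Some _ => False
  | Some p', Some q' => R p' q'
  end.

Lemma with_top_refl T (R : T -> T -> Prop) :
  (forall p, R p p) -> forall p, with_top R p p.
Proof. by move=> Rr [p|] //=. Qed.

Lemma with_top_trans T (R : T -> T -> Prop) :
  (forall p q r, R p q -> R q r -> R p r) ->
  forall p q r, with_top R p q -> with_top R q r -> with_top R p r.
Proof. by move=> Rt [p|] [q|] [r|] //=; exact: Rt. Qed.

Lemma with_top_none T (R : T -> T -> Prop) p : with_top R p None.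
Proof. by case: p. Qed.

Lemma end_extends_SCPm_refl p : end_extends_SCPm p p.
Proof. by []. Qed.

Lemma end_extends_SCPm_trans p q r :
  end_extends_SCPm p q -> end_extends_SCPm q r -> end_extends_SCPm p r.
Proof.
move=> [qp zpq] [rq zqr]; split; first exact: Order.POrderTheory.le_trans rq qp.
by move=> a ar; rewrite zqr// zpq//; exact: Order.POrderTheory.le_trans ar rq.
Qed.

Lemma end_extends_SCP_refl p : end_extends_SCP p p.
Proof. by []. Qed.

Lemma end_extends_SCP_trans p q r :
  end_extends_SCP p q -> end_extends_SCP q r -> end_extends_SCP p r.
Proof.
move=> [qp zpq] [rq zqr]; split; first exact: Order.POrderTheory.le_trans rq qp.
move=> a ar; have [-> ->] := zqr a ar.
by apply: zpq; exact: Order.POrderTheory.le_trans ar rq.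
Qed.

Definition P_SCPm : poset :=
  Poset (with_top_refl end_extends_SCPm_refl)
        (with_top_trans end_extends_SCPm_trans)
        (@with_top_none _ end_extends_SCPm).

Definition P_SCP : poset :=
  Poset (with_top_refl end_extends_SCP_refl)
        (with_top_trans end_extends_SCP_trans)
        (@with_top_none _ end_extends_SCP).

End ForcingSCP.

(* Main.v *)
(* Both parts are instances of one equivalence, parametrized by a clock
   [phi : W1 -> Y] through which the star-operation and the function f of SCP
   see the turn number: [phi = id] gives part (1), a constant [phi] part (2).

   MA for P_SCP gives SCP because every condition can be extended beyond any
   given height.  P_SCP is star-closed: II answers a countable set A of
   conditions by their union, topped at the supremum of the ordinals b^p + n
   (p in A) by the set of all these ordinals.  This set is increasing and
   continuous in A, so the tops of II's moves form a club as required by SCP.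

   Given SCP and a winning star-operation, II wins the game of length omega_2
   as follows.  At a turn g of cofinality omega she answers the set of those
   moves of I whose index is the successor of an element of z_g, reading the
   turn number off f(g).  Along a club as in SCP these sets form a play of the
   star-game, which takes her through the limits of cofinality omega_1.  For
   those of cofinality omega she moreover extends at each turn, for each of the
   at most aleph_1 finite sets of earlier turns, a finite play of the star-game
   attached to that set; this is possible because in a star-closed poset
   aleph_1 many open dense sets have a dense intersection.  Every increasing
   omega-sequence of turns then carries a play of the star-game of length
   omega. *)

Require Import Defs.
From mathcomp Require Import all_boot all_order.
From mathcomp Require Import boolp classical_sets functions cardinality wochoice.

Set Implicit Arguments.
Unset Strict Implicit.
Unset Printing Implicit Defensive.

Import Order.TTheory.

Local Open Scope order_scope.
Local Open Scope classical_set_scope.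
Local Open Scope card_scope.

(** * Choice from a set with a default, and comparison of cardinalities *)

Definition pick_in T (x0 : T) (A : set T) : T :=
  if pselect (A !=set0) is left h then projT1 (cid h) else x0.

Lemma pick_inP T (x0 : T) (A : set T) : A !=set0 -> A (pick_in x0 A).
Proof. by rewrite /pick_in; case: pselect => // h _; case: cid. Qed.

Lemma pick_in0 T (x0 : T) (A : set T) : ~ (A !=set0) -> pick_in x0 A = x0.
Proof. by rewrite /pick_in; case: pselect. Qed.

Lemma card_le_inj T U (f : T -> U) (A : set T) (B : set U) :
  (forall x, A x -> B (f x)) ->
  (forall x y, A x -> A y -> f x = f y -> x = y) -> A #<= B.
Proof.
move=> fAB fI; have fI' : {in A &, injective f}.
  by move=> x y /set_mem Ax /set_mem Ay; exact: fI.
rewrite -(card_le_eql (inj_card_eq fI')); apply: subset_card_le => _ [x Ax <-].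
exact: fAB.
Qed.

Lemma card_leP_inj T U (u0 : U) (A : set T) (B : set U) : A #<= B ->
  exists2 f : T -> U, (forall x, A x -> B (f x)) &
    (forall x y, A x -> A y -> f x = f y -> x = y).
Proof.
elim/Ppointed: U => U in u0 B *; first by case: (no u0).
move=> /pcard_leP/injfunPex[f fAB fI]; exists f; first exact: fAB.
by move=> x y Ax Ay; apply: fI; exact: mem_set.
Qed.

Lemma card_le_surj T U (x0 : T) (A : set T) (B : set U) : A #<= B ->
  exists g : U -> T, forall x, A x -> exists2 y, B y & g y = x.
Proof.
have [[u0]|nU] := pselect (inhabited U); last first.
  move=> AB; exists (fun u => x0) => x Ax; exfalso.
  case/card_leP: AB => f; apply: nU; apply: inhabits.
  exact: (set_val (f (SigSub (mem_set Ax)))).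
move=> /(card_leP_inj u0)[f fAB fI].
exists (fun u => pick_in x0 (A `&` [set x | f x = u])) => x Ax.
exists (f x); first exact: fAB.
have [/= Ay fy] : (A `&` [set y | f y = f x]) (pick_in x0 (A `&` [set y | f y = f x])).
  by apply: pick_inP; exists x.
exact: fI.
Qed.

(** * Well-ordered types *)

Section WellOrder.
Context {d : Order.disp_t} {W : orderType d}.
Hypothesis wo : well_order (<=%O : rel W).

Lemma wo_least (S : set W) : S !=set0 ->
  exists2 m, S m & forall x, S x -> m <= x.
Proof.
move=> [x Sx]; have [|m [[mS mle] _]] := wo (A := mem S).
  by exists x; exact: mem_set.
exists m; first exact: set_mem.
by move=> y Sy; apply: mle; exact: mem_set.
Qed.

Lemma least_exists : inhabited W -> exists o : W, forall a, o <= a.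
Proof.
move=> [w]; have [m _ mle] := @wo_least [set: W] (ex_intro _ w I).
by exists m => a; exact: mle.
Qed.

Lemma wo_ind (Q : W -> Prop) :
  (forall a, (forall b, b < a -> Q b) -> Q a) -> forall a, Q a.
Proof.
move=> IH a; apply: contrapT => nQa.
have [m nQm mle] := @wo_least [set b | ~ Q b] (ex_intro _ a nQa).
apply: nQm; apply: IH => b bm; apply: contrapT => /mle.
by rewrite leNgt bm.
Qed.

Lemma wo_wf : well_founded (fun a b : W => a < b).
Proof. by apply: wo_ind => a IH; constructor. Qed.

(** The history passed to [G] is a total function, cut to [x0] from [a] onwards, so that recursive
    definitions need no proof arguments. *)
Lemma wo_rec X (x0 : X) (G : W -> (W -> X) -> X) :
  exists F : W -> X, forall a, F a = G a (fun b => if b < a then F b else x0).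
Proof.
pose step a (h : forall b, b < a -> X) : X :=
  G a (fun b => if pselect (b < a) is left p then h b p else x0).
exists (Fix wo_wf (fun=> X) step) => a.
rewrite Fix_eq; last first.
  move=> c h h' hh'; congr (G c _); apply/funext => b.
  by case: pselect.
congr (G a _); apply/funext => b.
by case: pselect => [-> //|/negP/negbTE ->].
Qed.

Lemma nonlimitP (a : W) : ~ is_limit a ->
  (forall b, a <= b) \/ exists b, is_succ b a.
Proof.
move=> nl; have [b0|/existsNP[b /negP]] := pselect (forall b, a <= b).
  by left.
rewrite -ltNge => ba; right.
have /existsNP[c /not_implyP[ca cP]] :
    ~ forall b, b < a -> exists c, b < c /\ c < a.
  by move=> h; apply: nl; split; [exists b|].
exists c; split=> // e ea; rewrite leNgt; apply/negP => ce; apply: cP.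
by exists e.
Qed.

Lemma succ_nonlimit (a b : W) : is_succ a b -> ~ is_limit b.
Proof.
move=> [ab ba] [_ /(_ a ab)[c [ac cb]]]; have := ba c cb.
by rewrite leNgt ac.
Qed.

Lemma least_nonlimit (a : W) : (forall b, a <= b) -> ~ is_limit a.
Proof. by move=> h [[b ba] _]; move: (h b); rewrite leNgt ba. Qed.

Hypothesis nomax : forall a : W, exists b, a < b.

Definition succ (a : W) : W := pick_in a (is_succ a).

Lemma succP a : is_succ a (succ a).
Proof.
apply: pick_inP; have [m am mle] := @wo_least [set b | a < b] (nomax a).
exists m; split => // c cm; rewrite leNgt; apply/negP => /mle.
by rewrite leNgt cm.
Qed.

Lemma lt_succ a : a < succ a. Proof. exact: (succP a).1. Qed.

Lemma ltS a b : (a < succ b) = (a <= b).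
Proof.
by apply/idP/idP => [/(succP b).2//|/le_lt_trans]; apply; exact: lt_succ.
Qed.

Lemma leS a b : (succ a <= b) = (a < b).
Proof. by rewrite leNgt ltS -ltNge. Qed.

Lemma is_succE a b : is_succ a b -> b = succ a.
Proof.
move=> [ab ba]; apply/eqP; rewrite eq_le leS ab andbT leNgt; apply/negP => /ba.
by rewrite leS ltxx.
Qed.

Lemma limit_succ a b : is_limit b -> a < b -> succ a < b.
Proof.
move=> [_ bl] /bl[c [ac cb]]; apply: le_lt_trans cb.
by rewrite leS.
Qed.

Lemma nonlimit_succ a : ~ is_limit (succ a).
Proof. exact: succ_nonlimit (succP a). Qed.

Lemma nonlimit_cases (a : W) : ~ is_limit a ->
  (forall b, a <= b) \/ exists b, a = succ b.
Proof.
move=> /nonlimitP[]; first by left.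
by move=> [b /is_succE ->]; right; exists b.
Qed.

(* The interval [[a, a + omega)]. *)
Definition block (a : W) : set W := range (fun n => iter n succ a).

Lemma block_self a : block a a. Proof. by exists 0. Qed.

Lemma block_succ a x : block a x -> block a (succ x).
Proof. by move=> [n _ <-]; exists n.+1. Qed.

Lemma countable_block a : countable (block a).
Proof. exact: card_le_trans (card_image_le _ _) (countableP _). Qed.

(** Past its first element a block consists of successors, so a limit cannot fall strictly inside
    it. *)
Lemma block_limit a b x : is_limit b -> block a x -> b <= x -> b <= a.
Proof.
move=> bl [n _ <-]; elim: n => //= n IH; rewrite le_eqVlt ltS => /orP[/eqP bE|//].
by case: (@nonlimit_succ (iter n succ a)); rewrite -bE.
Qed.

Lemma block_lt a b x : is_limit b -> a < b -> block a x -> x < b.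
Proof. by move=> bl ab [n _ <-]; elim: n => //= n IH; exact: limit_succ. Qed.

(** The relation [cofinal_in S s] makes [s] the least strict upper bound of [S]; it serves as the
    supremum throughout. *)
Lemma cofinal_exists (S : set W) :
  (exists s, forall x, S x -> x < s) -> exists s, cofinal_in S s.
Proof.
move=> /(@wo_least [set s | forall x, S x -> x < s])[m mS mle].
exists m; split=> // b bm; apply: contrapT => nx.
move: bm; rewrite ltNge; case/negP; apply: mle => x Sx.
by rewrite ltNge; apply/negP => bx; apply: nx; exists x.
Qed.

Lemma cofinal_uniq (S : set W) s s' : cofinal_in S s -> cofinal_in S s' -> s = s'.
Proof.
wlog ss : s s' / s < s'.
  move=> H h h'; have [ss|ss|//] := ltgtP s s'; first exact: H.
  by symmetry; apply: H.
by move=> [Ss _] [_ /(_ s ss)[x /Ss xs]]; rewrite leNgt xs.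
Qed.

Lemma cofinal_limit (S : set W) s : S !=set0 -> (forall x, S x -> S (succ x)) ->
  cofinal_in S s -> is_limit s.
Proof.
move=> [x0 Sx0] SS [Ss sS]; split; first by exists x0; exact: Ss.
move=> b /sS[x Sx bx]; exists (succ x); split; last exact/Ss/SS.
by apply: (le_lt_trans bx); exact: lt_succ.
Qed.

Lemma mono_ge (g : W -> W) (a : W) :
  (forall x y, x < y -> y < a -> g x < g y) -> forall x, x < a -> x <= g x.
Proof.
move=> gm; apply: wo_ind => x IH xa; rewrite leNgt; apply/negP => gx.
have := gm _ _ gx xa; rewrite ltNge; case/negP.
by apply: IH => //; exact: lt_trans xa.
Qed.

End WellOrder.

(** If [a < b], following one isomorphism by the inverse of the other maps [below b] strictly
    increasingly into [below a]. This sends [a] below itself, against [mono_ge]. *)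
Lemma order_type_uniq d (W : orderType d) d' (W' : orderType d') (a b : W)
    (X : set W') : well_order (<=%O : rel W) ->
  same_order_type (below a) X -> same_order_type (below b) X -> a = b.
Proof.
move=> wo; wlog ab : a b / a < b.
  move=> H hX hX'; have [ab|ba|//] := ltgtP a b; first exact: H.
  by symmetry; apply: H.
move=> [g [gm gX]] [g' [gm' gX']]; exfalso.
pose h x := pick_in a (below a `&` [set y | g y = g' x]).
have hP x : x < b -> h x < a /\ g (h x) = g' x.
  move=> xb; apply: (@pick_inP _ a (below a `&` [set y | g y = g' x])).
  have : (g @` below a) (g' x) by rewrite gX -gX'; exists x.
  by move=> [y ya yx]; exists y.
have hm x y : x < y -> y < b -> h x < h y.
  move=> xy yb; have xb := lt_trans xy yb.
  have [hx gx] := hP x xb; have [hy gy] := hP y yb.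
  by rewrite gm //= gx gy -gm'.
have := mono_ge wo hm ab; rewrite leNgt.
by rewrite (hP a ab).1.
Qed.

Lemma order_type_range d (W : orderType d) d' (W' : orderType d')
    (h : W -> W') (c : W) : (forall x y, (x < y) = (h x < h y)) ->
  same_order_type (below c) (range h `&` below (h c)).
Proof.
move=> hm; exists h; split=> [x y _ _|]; first exact: hm.
apply/seteqP; split=> [_ [x xc <-]|_ [[x _ <-]]].
  by split; [exists x|rewrite /below/= -hm].
by rewrite /below/= -hm => xc; exists x.
Qed.

(** * Cardinal arithmetic of omega_1 *)

Section Omega1.
Context {d1 : Order.disp_t} {W1 : orderType d1}.
Hypothesis hW1 : is_omega1 W1.

Let wo1 : well_order (<=%O : rel W1). Proof. by case: hW1. Qed.

Lemma omega1_inh : inhabited W1.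
Proof.
apply: contrapT => nW; case: hW1 => _ + _; apply.
by have -> : [set: W1] = set0 by rewrite -subset0 => x _; apply: nW.
Qed.

Lemma countable_le1 (a : W1) : countable [set b | b <= a].
Proof.
have -> : [set b | b <= a] = [set b | b < a] `|` [set a].
  apply/seteqP; split=> x /=; rewrite le_eqVlt.
    by move=> /orP[/eqP|]; [right|left].
  by move=> [->|->]; rewrite ?eqxx ?orbT.
rewrite -bigcup2E; apply: bigcup_countable => [|i _]; first exact: countableP.
case: hW1 => _ _ cb; case: i => [|[|i]] //=; exact: countable1.
Qed.

Lemma nomax1 (a : W1) : exists b, a < b.
Proof.
apply: contrapT => /forallNP na; case: hW1 => _ + _; apply.
apply: sub_countable (countable_le1 a); apply: subset_card_le => b _ /=.
by rewrite leNgt; apply/negP/na.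
Qed.

Lemma countable_bounded1 (A : set W1) : countable A -> exists m, forall x, A x -> x < m.
Proof.
move=> cA; apply: contrapT => /forallNP nb; case: hW1 => _ + _; apply.
apply: (@sub_countable _ _ _ (\bigcup_(x in A) [set b | b <= x])).
  apply: subset_card_le => m _ /=; have /existsNP[x /not_implyP[Ax xm]] := nb m.
  by exists x => //=; rewrite leNgt; apply/negP.
by apply: bigcup_countable => // x _; exact: countable_le1.
Qed.

(** Distinct elements of [A] are chosen by recursion along [W1]: fewer than omega_1 steps use up
    only countably many of them. *)
Lemma uncountable_ge T (A : set T) : ~ countable A -> [set: W1] #<= A.
Proof.
move=> ncA; have [x0 _] : A !=set0.
  by apply/set0P; apply/eqP => A0; apply: ncA; rewrite A0.
have [g gE] := wo_rec wo1 x0 (fun a h => pick_in x0 (A `\` (h @` [set b | b < a]))).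
have gP a : A (g a) /\ forall b, b < a -> g b <> g a.
  have : (A `\` (g @` [set b | b < a])) !=set0.
    apply/set0P; apply/eqP => A0; apply: ncA.
    apply: (@sub_countable _ _ _ (g @` [set b | b < a])).
      by apply: subset_card_le; rewrite -setD_eq0.
    by apply: sub_countable (card_image_le _ _) _; case: hW1.
  move=> /(pick_inP x0); set A' := _ `\` _.
  have -> : pick_in x0 A' = g a.
    rewrite gE; congr (pick_in _ (_ `\` _)).
    by apply/seteqP; split => _ [b /= ba <-]; exists b; rewrite //= ba.
  by move=> [Ag ng]; split=> // b ba gb; apply: ng; exists b.
apply: (@card_le_inj _ _ g) => [a _|a b _ _ gab]; first exact: (gP a).1.
have [ab|ba|//] := ltgtP a b.
  by case: ((gP b).2 a ab).
by case: ((gP a).2 b ba).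
Qed.

(** The recursion places [G a] above the blocks of all earlier [G b]. The blocks are then disjoint,
    and [(a, n)] goes to the n-th element of the block of [G a]. *)
Lemma mul_omega_omega1 : exists g : W1 * nat -> W1, injective g.
Proof.
have [w0] := omega1_inh.
pose S := @succ _ W1.
have [G GE] := wo_rec wo1 w0 (fun a h =>
  pick_in w0 [set m | forall b n, b < a -> iter n S (h b) < m]).
have GP a b n : b < a -> iter n S (G b) < G a.
  have [m mP] : exists m, forall x,
      (\bigcup_(b in [set b | b < a]) block (G b)) x -> x < m.
    apply: countable_bounded1; apply: bigcup_countable; first by case: hW1.
    by move=> i _; exact: countable_block.
  move=> ba; rewrite [G a]GE; set A := [set m | _].
  have /(pick_inP w0)/(_ b n ba) : A !=set0; last by rewrite ba.
  exists m => b' k b'a; rewrite b'a.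
  by apply: mP; exists b' => //; exists k.
exists (fun p => iter p.2 S (G p.1)).
have iterS a n m : (n < m)%N -> iter n S a < iter m S a.
  elim: m => // m IH; rewrite ltnS leq_eqVlt => /orP[/eqP <-|/IH h] /=.
    exact: lt_succ wo1 nomax1 _.
  by apply: lt_trans h (lt_succ wo1 nomax1 _).
have ge a m : a <= iter m S a by case: m => // m; exact: ltW (iterS a 0%N m.+1 _).
have lt a b n m : a < b -> iter n S (G a) < iter m S (G b).
  by move=> ab; apply: lt_le_trans (GP _ _ n ab) (ge _ _).
move=> [a n] [b m] /= E; have [ab|ab|ab] := ltgtP a b.
- by have := lt _ _ n m ab; rewrite E ltxx.
- by have := lt _ _ m n ab; rewrite E ltxx.
subst b; have [nm|nm|->//] := ltngtP n m.
- by have := iterS (G a) _ _ nm; rewrite E ltxx.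
- by have := iterS (G a) _ _ nm; rewrite E ltxx.
Qed.

(** A pair is coded by its maximum [m] together with the numbers of its two entries in a fixed
    injection of the countable segment up to [m] into [nat]. *)
Lemma square_omega1 : exists g : W1 * W1 -> W1, injective g.
Proof.
have [g gI] := mul_omega_omega1.
have [e eI] : exists e : W1 -> W1 -> nat, forall a x y,
    x <= a -> y <= a -> e a x = e a y -> x = y.
  have /choice[e eI] : forall a : W1, exists f : W1 -> nat, forall x y,
      x <= a -> y <= a -> f x = f y -> x = y.
    move=> a; have /countable_injP[f fI] := countable_le1 a.
    by exists f => x y xa ya; apply: fI; exact: mem_set.
  by exists e.
exists (fun p => let m := Order.max p.1 p.2 in
  g (m, choice.pickle (e m p.1, e m p.2))).
move=> [x y] [x' y'] /= /gI[mE] /(pcan_inj choice.pickleK)[].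
have xm : x <= Order.max x y by rewrite le_max lexx.
have ym : y <= Order.max x y by rewrite le_max lexx orbT.
have xm' : x' <= Order.max x y by rewrite mE le_max lexx.
have ym' : y' <= Order.max x y by rewrite mE le_max lexx orbT.
by rewrite -mE => /(eI _ _ _ xm xm') xx /(eI _ _ _ ym ym') yy; rewrite xx yy.
Qed.

(** Iterated pairing is injective on lists of equal length only, so the length is recorded too. *)
Lemma seq_omega1 : exists g : seq W1 -> W1, injective g.
Proof.
have [w0] := omega1_inh.
have [p pI] := square_omega1; have [q qI] := mul_omega_omega1.
pose c := foldr (fun x y => p (x, y)) w0.
exists (fun s => q (c s, size s)) => s t /qI[] + +.
by elim: s t => [|x s IH] [|y t] //= /pI[-> /IH h] [/h ->].
Qed.

Lemma seq_card_le (T : eqType) (A : set T) : A #<= [set: W1] ->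
  [set s : seq T | forall x, x \in s -> A x] #<= [set: W1].
Proof.
have [w0] := omega1_inh; move=> /(card_leP_inj w0)[f _ fI].
have [g gI] := seq_omega1.
apply: (@card_le_inj _ _ (fun s => g (map f s))) => // s t /= + + /gI.
elim: s t => [|x s IH] [|y t] //= sA tA [fxy fst].
have -> : x = y by apply: fI fxy; [apply: sA|apply: tA]; exact: mem_head.
congr (_ :: _); apply: IH fst => z zs; [apply: sA|apply: tA];
  by rewrite inE zs orbT.
Qed.

End Omega1.

(** * Regularity of omega_2 and cofinalities below it *)

Section Omega2.
Context {d1 d2 : Order.disp_t} {W1 : orderType d1} {W2 : orderType d2}.
Hypothesis hW1 : is_omega1 W1.
Hypothesis hW2 : is_omega2 W1 W2.

Let wo1 : well_order (<=%O : rel W1). Proof. by case: hW1. Qed.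
Let wo2 : well_order (<=%O : rel W2). Proof. by case: hW2. Qed.

Lemma omega2_inh : inhabited W2.
Proof.
apply: contrapT => nW; case: hW2 => _ + _; apply.
have -> : [set: W2] = set0 by rewrite -subset0 => x _; apply: nW.
exact: card_ge0.
Qed.

(** If [g] were unbounded, each [y] would be determined by some [x] with [y <= g x] and by the code
    of [y] in the segment up to [g x]. This would inject [W2] into [W1 * W1], hence into [W1]. *)
Lemma range_bounded2 (g : W1 -> W2) : exists m, forall x, g x < m.
Proof.
have [w0] := omega1_inh hW1; have [p pI] := square_omega1 hW1.
apply: contrapT => /forallNP nb; case: hW2 => _ + le1; apply.
have /choice[x xP] : forall y, exists x, y <= g x.
  by move=> y; have /existsNP[x /negP] := nb y; rewrite -leNgt; exists x.
have /choice[h hI] : forall a, exists h : W2 -> W1,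
    forall y z, y < a -> z < a -> h y = h z -> y = z.
  by move=> a; have /(card_leP_inj w0)[h _ hI] := le1 a; exists h.
(* The injection of [below a] is extended to the closed segment, with [None] coding [a] itself. *)
pose h' a y := if y == a then None else Some (h a y).
have h'I a y z : y <= a -> z <= a -> h' a y = h' a z -> y = z.
  rewrite /h' !le_eqVlt; case: eqP => [->|_]; case: eqP => [->|_] //= ya za.
  by move=> -[]; exact: hI.
have [o oI] : exists o : option W1 -> W1, injective o.
  have [q qI] := mul_omega_omega1 hW1.
  exists (fun u => if u is Some a then q (a, 1%N) else q (w0, 0%N)).
  by move=> [a|] [b|] // /qI[] // ->.
apply: (@card_le_inj _ _ (fun y => p (x y, o (h' (g (x y)) y)))) => // y z _ _.
move=> /pI[xE /oI]; rewrite -xE; apply: h'I; first exact: xP.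
by rewrite xE; exact: xP.
Qed.

Lemma bounded2 (S : set W2) : S #<= [set: W1] -> exists m, forall x, S x -> x < m.
Proof.
have [y0] := omega2_inh; move=> /(card_le_surj y0)[g gS].
have [m mP] := range_bounded2 g; exists m => x /gS[y _ <-]; exact: mP.
Qed.

Lemma countable_le_omega1 T (S : set T) : countable S -> S #<= [set: W1].
Proof.
have [w0] := omega1_inh hW1; have [q qI] := mul_omega_omega1 hW1.
move=> /(card_leP_inj 0%N)[f _ fI].
apply: (@card_le_inj _ _ (fun x => q (w0, f x))) => // x y Sx Sy /qI[].
exact: fI.
Qed.

Lemma nomax2 (a : W2) : exists b, a < b.
Proof.
have [m mP] := @bounded2 [set a] (countable_le_omega1 (countable1 a)).
by exists m; exact: mP.
Qed.

Lemma cofinal_nonempty (A : set W2) a : is_limit a -> cofinal_in A a -> A !=set0.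
Proof. by move=> [[b ba] _] [_ /(_ b ba)[c Ac _]]; exists c. Qed.

Lemma cofinal_gt (A : set W2) a b : is_limit a -> cofinal_in A a -> b < a ->
  exists2 c, A c & b < c.
Proof.
move=> [_ la] [_ Aa] /la[c [bc /Aa[e Ae ce]]]; exists e => //.
exact: lt_le_trans ce.
Qed.

Lemma cofinal_limit_infinite (A : set W2) a : is_limit a -> cofinal_in A a ->
  infinite_set A.
Proof.
move=> la cA /finite_seqP[s As].
have : forall s : seq W2, (forall x, x \in s -> x < a) ->
    exists2 b, b < a & forall x, x \in s -> x <= b.
  elim=> [_|x t IH ta]; first by case: la => -[b ba] _; exists b.
  have [|b ba bP] := IH; first by move=> y yt; apply: ta; rewrite inE yt orbT.
  exists (Order.max x b); first by rewrite gt_max ba ta // inE eqxx.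
  move=> y; rewrite inE le_max => /orP[/eqP ->|/bP ->]; rewrite ?lexx ?orbT //.
move=> /(_ s)[x xs|b ba bP]; first by apply: cA.1; rewrite As.
have [c Ac bc] := cofinal_gt la cA ba.
by move: bc; rewrite ltNge bP //; move: Ac; rewrite As.
Qed.

(** Every cofinal subset of a limit is infinite, so one countable cofinal subset already fixes the
    cofinality. *)
Lemma S20_intro (A : set W2) a : is_limit a -> countable A -> cofinal_in A a ->
  S20 a.
Proof.
move=> la cA Aa; split; last first.
  by move=> B /(cofinal_limit_infinite la)/infiniteP.
by exists A => //; apply: eq_card_nat cA _; apply: cofinal_limit_infinite Aa.
Qed.

Lemma infinite_cofinal_limit (a : W2) :
  (forall A, cofinal_in A a -> infinite_set A) -> is_limit a.
Proof.
move=> inf; apply: contrapT => /(nonlimit_cases wo2 nomax2)[a0|[b aE]].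
  apply: (inf set0) => //; split=> // b.
  by rewrite ltNge a0.
apply: (inf [set b]) => //; split=> [_ -> |c].
  by rewrite /below/= aE lt_succ // => x; exact: nomax2.
by rewrite aE ltS // => [cb|x]; [exists b|exact: nomax2].
Qed.

Lemma S20_limit (a : W2) : S20 a -> is_limit a.
Proof. by move=> [_ inf]; apply: infinite_cofinal_limit => A /inf/infiniteP. Qed.

Lemma S20_cofinal (a : W2) : S20 a -> exists A, countable_cofinal A a.
Proof.
move=> [[A Aa An] _]; exists A; split=> //; by rewrite (eq_countable An).
Qed.

Lemma S21_uncountable (a : W2) A : S21 W1 a -> cofinal_in A a -> ~ countable A.
Proof.
move=> [_ h] /h WA cA; case: hW1 => _ + _; apply; exact: sub_countable WA cA.
Qed.

Lemma S21_limit (a : W2) : S21 W1 a -> is_limit a.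
Proof.
move=> Sa; apply: infinite_cofinal_limit => A Aa fA.
by apply: (S21_uncountable Sa Aa); exact: finite_set_countable.
Qed.

Lemma S21_S20 (a : W2) : S21 W1 a -> ~ S20 a.
Proof.
by move=> Sa /S20_cofinal[A [cA Aa]]; exact: S21_uncountable Sa Aa cA.
Qed.

(** Without a countable cofinal subset, all cofinal subsets have size at least aleph_1, and
    [below a] itself has size at most aleph_1. *)
Lemma limit_S20_S21 (a : W2) : is_limit a -> S20 a \/ S21 W1 a.
Proof.
move=> la; have [|nS] := pselect (S20 a); [by left|right].
have unc A : cofinal_in A a -> [set: W1] #<= A.
  move=> Aa; apply: (uncountable_ge hW1) => cA; apply: nS.
  exact: S20_intro Aa.
split=> //; exists (below a).
  by split => // b ba; exists b.
have aa : cofinal_in (below a) a by split=> // b ba; exists b.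
by rewrite card_eq_le (unc _ aa) andbT; case: hW2 => _ _; exact.
Qed.

(** This yields conditions with the same top that disagree there, hence incompatible ones; removing
    one point from [A] is enough. *)
Lemma cofinal_other (A B : set W2) a : is_limit a -> countable_cofinal A a ->
  exists2 A', countable_cofinal A' a & A' <> B.
Proof.
move=> la cA; have [AB|] := pselect (A = B); last by exists A.
have [x Ax] := cofinal_nonempty la cA.2; exists (A `\ x); last first.
  by rewrite -AB => E; move: Ax; rewrite -E => -[_ /(_ erefl)].
split; first by apply: sub_countable cA.1; apply: subset_card_le => y [].
split=> [y [/cA.2.1]//|b ba].
have [|c Ac cP] := @cofinal_gt A a (Order.max b x) la cA.2.
  by rewrite gt_max ba; exact: cA.2.1.
move: cP; rewrite gt_max => /andP[bc xc]; exists c; last exact: ltW.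
by split=> // cx; move: xc; rewrite cx ltxx.
Qed.

Lemma below_seq_card (a : W2) :
  [set s : seq W2 | forall x, x \in s -> x < a] #<= [set: W1].
Proof. by apply: seq_card_le => //; case: hW2 => _ _; exact. Qed.

Lemma cofinal_seq (A : set W2) a : is_limit a -> countable_cofinal A a ->
  exists u : nat -> W2, [/\ forall n, u n < a, forall n, u n < u n.+1
    & forall b, b < a -> exists n, b <= u n].
Proof.
move=> la [cA Aa]; have [x0 Ax0] := cofinal_nonempty la Aa.
have [g gP] := card_le_surj x0 cA.
pose v n := if `[< A (g n) >] then g n else x0.
have vA n : A (v n) by rewrite /v; case: asboolP.
(* Taking the maximum with the successor of the previous term makes the sequence strictly increasing
   while it still dominates the enumeration [v] of [A]. *)
pose u := fix u n := if n is m.+1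
  then Order.max (v n) (succ (u m)) else v 0%N.
have ua n : u n < a.
  elim: n => [|n IH] /=; first exact: Aa.1.
  rewrite gt_max Aa.1 //=; by apply: limit_succ => //; exact: nomax2.
exists u; split=> // [n|b ba] /=.
  by rewrite lt_max (lt_succ wo2) ?orbT // => x; exact: nomax2.
have [c Ac bc] := Aa.2 b ba; have [n _ gn] := gP c Ac; exists n.
apply: (le_trans bc); have -> : c = v n by rewrite /v gn; case: asboolP.
by case: n {gn} => //= n; rewrite le_max lexx.
Qed.

End Omega2.

(** * Plays of the star-game *)

Section StarPlays.
Context {d1 : Order.disp_t} {W1 : orderType d1}.
Hypothesis hW1 : is_omega1 W1.
Variable P : poset.
Variable t : star_operation P W1.
Hypothesis tw : star_winning t.

Let wo1 : well_order (<=%O : rel W1). Proof. by case: hW1. Qed.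
Let nm1 : forall a : W1, exists b, a < b. Proof. exact: nomax1. Qed.

(** Player I names one new condition per turn and plays the set of all those named so far; thus a
    sequence of conditions determines a play. *)
Definition point_moves (x : W1 -> P) (c : W1) : set P :=
  x @` [set e | e <= c /\ ~ is_limit e].

Lemma star_set_points x c : star_set (point_moves x) c = point_moves x c.
Proof.
rewrite /star_set; case: asboolP => // lc; apply/seteqP; split=> p.
  move=> [e [ec nl] [e' [e'e nl'] <-]]; exists e' => //; split=> //.
  exact: le_trans e'e (ltW ec).
move=> [e [ec nl] <-]; exists e; last by exists e.
by split=> //; move: ec; rewrite le_eqVlt => /orP[/eqP ec|//]; case: nl; rewrite ec.
Qed.

Lemma countable_points x c : countable (point_moves x c).
Proof.
apply: sub_countable (card_image_le _ _) _.
by apply: sub_countable (countable_le1 hW1 c); apply: subset_card_le => e [].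
Qed.

Lemma points_le x e : ~ is_limit e ->
  (forall e', succ e' <= e -> ple (x (succ e')) (t e' (point_moves x e'))) ->
  (forall e', e' < e -> common_extension (point_moves x e') (t e' (point_moves x e'))) ->
  common_extension (point_moves x e) (x e).
Proof.
move=> nl xt IH _ [e' [e'e nl'] <-].
move: e'e; rewrite le_eqVlt => /orP[/eqP ->|e'e]; first exact: ple_refl.
have [e0|[e'' eE]] := nonlimit_cases wo1 nm1 nl.
  by move: e'e; rewrite ltNge e0.
subst e; apply: ple_trans (xt _ (lexx _)) _.
apply: IH; first exact: lt_succ.
by exists e' => //; split=> //; rewrite -ltS.
Qed.

Lemma points_legal x e : ~ is_limit e ->
  (forall e', succ e' <= e -> ple (x (succ e')) (t e' (point_moves x e'))) ->
  (forall e', e' < e -> common_extension (point_moves x e') (t e' (point_moves x e'))) ->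
  star_I_legal (point_moves x) (fun c => t c (star_set (point_moves x) c)) e.
Proof.
move=> nl xt IH; split.
- split; [by exists (x e), e|exact: countable_points|exists (x e)].
  exact: points_le.
- move=> e' e'e _ p [f [fe' nlf] <-]; exists f => //; split=> //.
  exact: le_trans fe' (ltW e'e).
- move=> e' /(is_succE wo1 nm1) eE; rewrite star_set_points => p pB.
  have /= pe : bc_set (bc_embed (x e)) p.
    by apply: (pB (bc_embed (x e))); exists (x e) => //; exists e.
  move=> r /pe[s [sr sx]]; exists s; split=> //; apply: ple_trans sx _.
  by rewrite eE; apply: xt; rewrite eE.
Qed.

(** It is enough that each new point extends II's previous answer, which in turn extends all earlier
    points. The legality of I's move at [e] rests on II's answers before [e], hence the
    induction. *)
Lemma play_points x c :
  (forall e, succ e <= c -> ple (x (succ e)) (t e (point_moves x e))) ->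
  common_extension (point_moves x c) (t c (point_moves x c)).
Proof.
move: c; apply: (wo_ind wo1) => c IH xt.
have IH' e : e < c -> common_extension (point_moves x e) (t e (point_moves x e)).
  by move=> ec; apply: IH => // e' e'e; apply: xt; exact: le_trans e'e (ltW ec).
have [/(_ c) + _] := tw (point_moves x); rewrite star_set_points; apply.
move=> e ec nl; apply: points_legal => // e' e'e.
  by apply: xt; exact: le_trans ec.
by apply: IH'; exact: lt_le_trans ec.
Qed.

Lemma play_points_end x :
  (forall e, ple (x (succ e)) (t e (point_moves x e))) ->
  exists p, forall e, ~ is_limit e -> ple p (x e).
Proof.
move=> xt; have [_ []] := tw (point_moves x).
  by move=> e nl; apply: points_legal => // e' _; apply: play_points.
move=> p pP; exists p => e nl; apply: pP; exists e => //.
by exists e.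
Qed.

(** Player I enters [D e] at turn [succ e]. The final common extension of the play lies below all
    his moves, hence in every [D e]. *)
Lemma star_baire (D : W1 -> set P) p0 :
  (forall e q, ple q p0 -> exists2 r, D e r & ple r q) ->
  (forall e q r, D e q -> ple r q -> D e r) ->
  exists2 q, ple q p0 & forall e, D e q.
Proof.
move=> Dd Do.
(* While [x] is being built, II's answers are not yet known to lie below [p0], so the demand to
   extend them is conditional; [xt] below discharges the condition by induction. *)
have [x xE] := wo_rec wo1 p0 (fun c h => pick_in p0
  [set q | ple q p0 /\ forall e, c = succ e ->
    D e q /\ (ple (t e (point_moves h e)) p0 -> ple q (t e (point_moves h e)))]).
have pm e c : e < c ->
    point_moves (fun b => if b < c then x b else p0) e = point_moves x e.
  by move=> ec; apply: eq_imagel => b [be _]; rewrite (le_lt_trans be ec).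
have xP c : ple (x c) p0 /\ forall e, c = succ e -> D e (x c) /\
    (ple (t e (point_moves x e)) p0 -> ple (x c) (t e (point_moves x e))).
  rewrite xE; set A := [set q | _].
  have : A !=set0.
    have [[e ce]|nc] := pselect (exists e, c = succ e); last first.
      by exists p0; split; [exact: ple_refl|move=> e ce; case: nc; exists e].
    have ec : e < c by rewrite ce lt_succ.
    have [q [qp qt]] : exists q, ple q p0 /\ (ple (t e (point_moves x e)) p0 ->
        ple q (t e (point_moves x e))).
      have [h|h] := pselect (ple (t e (point_moves x e)) p0).
        by exists (t e (point_moves x e)); split=> // _; exact: ple_refl.
      by exists p0; split; first exact: ple_refl.
    have [r Dr rq] := Dd e q qp; exists r; split; first exact: ple_trans qp.
    move=> e' ce'; have -> : e' = e.
      apply/eqP; rewrite eq_le -!(ltS wo1 nm1) -ce' ce ?lt_succ //.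
      by rewrite -ce ce' lt_succ.
    by rewrite pm // ; split=> // /qt; exact: ple_trans.
  move=> /(pick_inP p0)[qp qP]; split=> // e ce.
  have ec : e < c by rewrite ce lt_succ.
  by have := qP e ce; rewrite pm.
have xt e : ple (x (succ e)) (t e (point_moves x e)).
  move: e; apply: (wo_ind wo1) => e IH.
  apply: ((xP (succ e)).2 e erefl).2.
  have [m m0] := least_exists wo1 (omega1_inh hW1).
  apply: (ple_trans (q := x m)); last exact: (xP m).1.
  apply: play_points => [e' e'e|]; first by apply: IH; rewrite -(leS wo1 nm1).
  by exists m => //; split=> //; exact: least_nonlimit.
have [q qx] := play_points_end xt; exists q.
  have [w0] := omega1_inh hW1.
  exact: ple_trans (qx _ (@nonlimit_succ _ _ wo1 nm1 w0)) (xP _).1.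
move=> e; apply: Do (qx _ (@nonlimit_succ _ _ wo1 nm1 e)).
exact: ((xP (succ e)).2 e erefl).1.
Qed.

End StarPlays.

(** * Plays of finite length and of length omega *)

Section FinitePlays.
Context {d1 : Order.disp_t} {W1 : orderType d1}.
Hypothesis hW1 : is_omega1 W1.
Variable P : poset.
Variable t : star_operation P W1.
Hypothesis tw : star_winning t.

Let wo1 : well_order (<=%O : rel W1). Proof. by case: hW1. Qed.
Let nm1 : forall a : W1, exists b, a < b. Proof. exact: nomax1. Qed.

Variable o : W1.
Hypothesis o_least : forall a, o <= a.

Definition fin_ord (n : nat) : W1 := iter n succ o.

Lemma fin_ord_lt m n : (m < n)%N -> fin_ord m < fin_ord n.
Proof.
elim: n => // n IH; rewrite ltnS leq_eqVlt => /orP[/eqP ->|/IH mn].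
  exact: lt_succ.
by apply: lt_trans mn _; exact: lt_succ.
Qed.

Lemma fin_ord_le m n : (fin_ord m <= fin_ord n) = (m <= n)%N.
Proof.
case: (leqP m n) => [|/fin_ord_lt mn]; last by rewrite leNgt mn.
by rewrite leq_eqVlt => /orP[/eqP ->|/fin_ord_lt/ltW//]; rewrite lexx.
Qed.

Lemma fin_ord_inj : injective fin_ord.
Proof.
move=> m n mn; apply/eqP; rewrite eqn_leq.
by rewrite -!fin_ord_le mn !lexx.
Qed.

Lemma fin_ord_nonlimit n : ~ is_limit (fin_ord n).
Proof.
case: n => [|n]; first exact: least_nonlimit.
exact: nonlimit_succ wo1 nm1 _.
Qed.

Lemma le_fin_ord e n : e <= fin_ord n -> exists2 m, (m <= n)%N & e = fin_ord m.
Proof.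
elim: n => [|n IH].
  by move=> eo; exists 0%N => //; apply/eqP; rewrite eq_le eo o_least.
rewrite le_eqVlt => /orP[/eqP ->|]; first by exists n.+1.
by rewrite ltS // => /IH[m mn ->]; exists m => //; exact: leqW.
Qed.

(** A sequence indexed by [nat] is read as moves at the finite turns; other turns get the default
    [c 0]. *)
Definition moves_of (c : nat -> P) (e : W1) : P :=
  c (pick_in 0%N [set n | fin_ord n = e]).

Lemma moves_ofE c n : moves_of c (fin_ord n) = c n.
Proof.
rewrite /moves_of; congr c; apply: fin_ord_inj.
by apply: (@pick_inP _ 0%N [set k | fin_ord k = fin_ord n]); exists n.
Qed.

Lemma points_fin c n :
  point_moves (moves_of c) (fin_ord n) = c @` [set i | (i < n.+1)%N].
Proof.
apply/seteqP; split=> p.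
  move=> [_ [/le_fin_ord[m mn ->] _] <-]; rewrite moves_ofE.
  by exists m.
move=> [m /= mn <-]; exists (fin_ord m); last exact: moves_ofE.
by split; [rewrite fin_ord_le|exact: fin_ord_nonlimit].
Qed.

Definition fin_move (n : nat) (A : set P) : P := t (fin_ord n) A.

Lemma fin_play_le (c : nat -> P) N :
  (forall n, (n < N)%N -> ple (c n.+1) (fin_move n (c @` [set i | (i < n.+1)%N]))) ->
  ple (fin_move N (c @` [set i | (i < N.+1)%N])) (c N).
Proof.
move=> ct; rewrite /fin_move -points_fin.
apply: (play_points hW1 tw (x := moves_of c)).
  move=> e eN; have [m mN eE] := le_fin_ord (le_trans (ltW (lt_succ wo1 nm1 e)) eN).
  rewrite eE points_fin -[succ _]/(fin_ord m.+1) moves_ofE; apply: ct.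
  by move: eN; rewrite eE -[succ _]/(fin_ord m.+1) fin_ord_le.
by rewrite points_fin; exists N => //=; exact: ltnSn.
Qed.

(** The lower bound is II's answer at turn omega, obtained as the supremum [w] of the finite
    turns. *)
Lemma fin_play_lim (c : nat -> P) :
  (forall n, ple (c n.+1) (fin_move n (c @` [set i | (i < n.+1)%N]))) ->
  exists p, forall n, ple p (c n).
Proof.
move=> ct.
have [w wP] : exists w, cofinal_in (range fin_ord) w.
  apply: cofinal_exists => //; apply: countable_bounded1 => //.
  exact: card_le_trans (card_image_le _ _) (countableP _).
exists (t w (point_moves (moves_of c) w)) => n.
apply: (play_points hW1 tw (x := moves_of c)) => [e ew|].
  have [_ [m _ <-] em] := wP.2 e (lt_le_trans (lt_succ wo1 nm1 e) ew).
  have [k _ ->] := le_fin_ord em.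
  by rewrite points_fin -[succ _]/(fin_ord k.+1) moves_ofE; exact: ct.
exists (fin_ord n); last exact: moves_ofE.
by split; [apply/ltW/wP.1; exists n|exact: fin_ord_nonlimit].
Qed.

(* Finite plays are recorded most recent move first. *)
Definition list_move (l : seq P) : P :=
  fin_move (size l).-1 [set nth pone (rev l) i | i in [set i | (i < size l)%N]].

Fixpoint legal_list (l : seq P) : Prop :=
  if l is c :: h then legal_list h /\ (h <> [::] -> ple c (list_move h))
  else True.

Lemma legal_listP l : legal_list l -> forall n, (n.+1 < size l)%N ->
  ple (nth pone (rev l) n.+1)
      (fin_move n [set nth pone (rev l) i | i in [set i | (i < n.+1)%N]]).
Proof.
elim: l => // c h IH [lh ch] n; rewrite [size _]/= ltnS => nh.
have -> : [set nth pone (rev (c :: h)) i | i in [set i | (i < n.+1)%N]] =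
          [set nth pone (rev h) i | i in [set i | (i < n.+1)%N]].
  apply: eq_imagel => i /= ni; rewrite rev_cons nth_rcons size_rev.
  by rewrite (leq_trans ni nh).
rewrite rev_cons nth_rcons size_rev.
move: nh; rewrite leq_eqVlt => /orP[/eqP nh|nh]; last by rewrite nh; exact: IH.
rewrite nh ltnn eqxx; have := ch; rewrite /list_move -nh; apply.
by move=> h0; move: nh; rewrite h0.
Qed.

Lemma list_move_le c h : legal_list (c :: h) -> ple (list_move (c :: h)) c.
Proof.
move=> lch; have := @fin_play_le (nth pone (rev (c :: h))) (size h).
have -> : nth pone (rev (c :: h)) (size h) = c.
  by rewrite rev_cons nth_rcons size_rev ltnn eqxx.
by apply=> n nh; apply: legal_listP.
Qed.

(** The lists [H n] are the initial segments of one play of length omega, so [fin_play_lim]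
    applies. *)
Lemma list_move_lim (H : nat -> seq P) (c : nat -> P) :
  H 0%N = [::] -> (forall n, H n.+1 = c n :: H n) ->
  (forall n, ple (c n.+1) (list_move (H n.+1))) -> exists p, forall n, ple p (c n).
Proof.
move=> H0 HS ct; apply: fin_play_lim => n; have := ct n.
have sH m : size (H m) = m by elim: m => [|m IH]; rewrite ?H0 ?HS //= IH.
rewrite /list_move sH; congr (ple _ (fin_move _ _)).
apply: eq_imagel => i /=; elim: n => [|n IH] //.
  by rewrite ltnS leqn0 => /eqP ->; rewrite HS H0.
rewrite HS rev_cons nth_rcons size_rev sH ltnS leq_eqVlt => /orP[/eqP ->|ni].
  by rewrite ltnn eqxx.
by rewrite ni; exact: IH.
Qed.

End FinitePlays.

(** Player I plays against the winning strategy, extending II's answer into the dense set of index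
    [e] at turn [succ e]. II's moves generate the required filter. *)
Lemma strategically_closed_MA d (W : orderType d) (P : poset) :
  well_order (<=%O : rel W) -> (forall a : W, exists b, a < b) -> inhabited W ->
  strategically_closed P W -> MA P W.
Proof.
move=> wo nm [w0] [s ss sw] DD /(card_leP_inj w0)[i _ iI] DDd.
(* This is the member of [DD] with index [a] under the injection [i], or all of [P] when [a] is not
   an index. *)
pose D a := [set p : P | forall E, DD E -> i E = a -> E p].
have Dd a p : exists2 q, D a q & ple q p.
  have [[E [DE iE]]|nE] := pselect (exists E, DD E /\ i E = a); last first.
    by exists p; [move=> E DE iE; case: nE; exists E|exact: ple_refl].
  have [q Eq qp] := DDd E DE p; exists q => // E' DE' iE'.
  by have -> : E' = E by apply: iI => //; rewrite iE'.
(* Only successor turns are constrained: the first move is arbitrary, and the values at limit turns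
   are not moves. *)
have [a aE] := wo_rec wo (@pone P) (fun c h => pick_in pone
  [set q | forall e, c = succ e -> ple q (s e h) /\ D e q]).
have aP e : ple (a (succ e)) (s e a) /\ D e (a (succ e)).
  pose h b := if b < succ e then a b else pone.
  (* The strategy at turn [e] sees the moves up to [e] only, so it cannot tell [a] from the part
     built before [succ e]. *)
  have sE : s e a = s e h.
    by apply: ss => b be _; rewrite /h ltS // be.
  rewrite sE; have := aE (succ e); rewrite -/h; set A := [set q | _].
  move=> ->; suff /(pick_inP pone)/(_ e erefl) : A !=set0 by [].
  have [q Dq qs] := Dd e (s e h).
  exists q => e' ee'; suff <- : e = e' by [].
  apply/eqP; rewrite eq_le -!(ltS wo nm) -ee' ee' lt_succ //.
  by rewrite -ee' lt_succ.
pose b := s^~ a.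
have bP c : II_legal a b c.
  move: c; apply: (wo_ind wo) => c IH; apply: sw => e ec nl.
  have [e0|[f ef]] := nonlimit_cases wo nm nl.
    by move=> f; rewrite ltNge e0.
  subst e; have fc : f < c by apply: lt_le_trans ec; exact: lt_succ.
  move=> g; rewrite ltS // => gf; split; last first.
    apply: ple_trans (aP f).1 _; move: gf; rewrite le_eqVlt => /orP[/eqP ->|gf].
      exact: ple_refl.
    exact: (IH f fc).2.
  by move=> ng; apply: ple_trans (aP f).1 _; exact: (IH f fc).1.
have bm e c : e <= c -> ple (b c) (b e).
  rewrite le_eqVlt => /orP[/eqP ->|ec]; first exact: ple_refl.
  exact: (bP c).2.
exists [set p | exists c, ple (b c) p]; last first.
  move=> E DE; exists (a (succ (i E))); split; first exact: (aP (i E)).2.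
  exists (succ (i E)); apply: (bP _).1 => //; exact: nonlimit_succ.
split.
- by exists (b w0); exists w0; exact: ple_refl.
- by move=> p q [c cp] pq; exists c; exact: ple_trans pq.
- move=> p q [c cp] [e eq]; exists (b (Order.max c e)).
  split; first by exists (Order.max c e); exact: ple_refl.
    by apply: ple_trans cp; apply: bm; rewrite le_max lexx.
  by apply: ple_trans eq; apply: bm; rewrite le_max lexx orbT.
Qed.

(** * Strategic closedness from SCP *)

Section Clock.
Context {d1 d2 : Order.disp_t} {W1 : orderType d1} {W2 : orderType d2}.
Context {Y : Type} (phi : W1 -> Y).

(* [SCP] is the case [phi = id], and [SCPm] the case of a constant [phi]; the
   same holds for the two notions of closedness below. *)
Definition clocked_club (z : W2 -> set W2) (f : W2 -> Y) (b : W2) : Prop :=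
  exists2 C, climbing_club W1 z b C & forall a c, C a ->
    same_order_type (below c) (C `&` below a) -> f a = phi c.

Definition clocked_SCP : Prop := exists z f,
  (forall a, S20 a -> countable_cofinal (z a) a) /\
  (forall b, S21 W1 b -> clocked_club z f b).

Definition clocked_closed (P : poset) : Prop :=
  exists2 t : star_operation P W1, star_winning t & forall c c' A,
    countable_plus A -> phi c = phi c' -> t c A = t c' A.

End Clock.

Section Strategy.
Context {d1 d2 : Order.disp_t} {W1 : orderType d1} {W2 : orderType d2}.
Hypothesis hW1 : is_omega1 W1.
Hypothesis hW2 : is_omega2 W1 W2.
Context {Y : Type} (phi : W1 -> Y).
Variables (z : W2 -> set W2) (f : W2 -> Y).
Hypothesis z_cofinal : forall a, S20 a -> countable_cofinal (z a) a.
Hypothesis z_club : forall b, S21 W1 b -> clocked_club phi z f b.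
Variables (P : poset) (t : star_operation P W1).
Hypothesis tw : star_winning t.
Hypothesis t_phi : forall c c' A,
  countable_plus A -> phi c = phi c' -> t c A = t c' A.
Variable o : W1.
Hypothesis o_least : forall a, o <= a.

Let wo1 : well_order (<=%O : rel W1). Proof. by case: hW1. Qed.
Let wo2 : well_order (<=%O : rel W2). Proof. by case: hW2. Qed.
Let nm1 : forall a : W1, exists b, a < b. Proof. exact: nomax1. Qed.
Let nm2 : forall a : W2, exists b, a < b. Proof. exact: (nomax2 hW1 hW2). Qed.

(** The shift to successors avoids the limit turns, which I skips, and places the move used for [x]
    below II's answer at [x]. *)
Definition past_moves (a : W2 -> P) (g : W2) : set P :=
  [set a (succ x) | x in z g].

(** The function [f] gives the clock reading only. Any turn with this reading will do, since [t]
    depends on the turn only through [phi]. *)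
Definition limit_move (a : W2 -> P) (g : W2) : P :=
  t (pick_in o [set c | phi c = f g]) (past_moves a g).

Definition state : Type := P * (seq W2 -> P).

(** The list [s] holds a finite set of turns, latest first. The move at [e] belongs to the play
    attached to the listed turns before [e], so it is looked up at the tail. *)
Fixpoint history (r : W2 -> state) (s : seq W2) : seq P :=
  if s is e :: s' then (r e).2 s' :: history r s' else [::].

(* The second component of the state at turn [g] continues, at [g], the finite
   star-play attached to each finite set [s] of earlier turns; this is what
   keeps II alive at the limits of cofinality omega. *)
Definition good_state (g : W2) (a : W2 -> P) (r : W2 -> state) (x : state) : Prop :=
  [/\ forall e, e <= g -> ~ is_limit e -> ple x.1 (a e),
      forall e, e < g -> ple x.1 (r e).1,
      forall s, path >%O g s ->
        (forall e s', s = e :: s' -> ple (x.2 s) (r e).1) /\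
        ple x.1 (list_move t o (x.2 s :: history r s))
    & S20 g -> common_extension (past_moves a g) (limit_move a g) ->
        ple x.1 (limit_move a g)].

Lemma path_gt_lt (g : W2) s : path >%O g s -> forall x, x \in s -> x < g.
Proof.
elim: s g => // e s IH g /= /andP[eg /IH es] x; rewrite inE => /orP[/eqP ->|/es xe] //.
exact: lt_trans xe eg.
Qed.

Lemma history_ext g r r' s : path >%O g s ->
  (forall e, e < g -> r e = r' e) -> history r s = history r' s.
Proof.
elim: s g => // e s IH g /= /andP[eg es] rr'; rewrite rr' // (IH e) //.
by move=> b be; apply: rr'; exact: lt_trans eg.
Qed.

Lemma past_moves_ext g a a' : S20 g ->
  (forall e, e <= g -> ~ is_limit e -> a e = a' e) ->
  past_moves a g = past_moves a' g.
Proof.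
move=> Sg aa'; apply: eq_imagel => x zx; apply: aa'; last exact: nonlimit_succ.
by rewrite leS //; exact: (z_cofinal Sg).2.1.
Qed.

Lemma good_state_ext g a a' r r' x :
  (forall e, e <= g -> ~ is_limit e -> a e = a' e) ->
  (forall e, e < g -> r e = r' e) ->
  good_state g a r x -> good_state g a' r' x.
Proof.
move=> aa' rr' [xa xr xs xl]; split.
- by move=> e eg nl; rewrite -aa' //; exact: xa.
- by move=> e eg; rewrite -rr' //; exact: xr.
- move=> s gs; rewrite -(history_ext gs rr'); have [xh xm] := xs s gs; split=> //.
  move=> e s' sE; rewrite -rr'; first exact: xh sE.
  by apply: (path_gt_lt gs); rewrite sE mem_head.
- by move=> Sg; rewrite /limit_move -(past_moves_ext Sg aa'); exact: xl.
Qed.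

(** * A single turn: lower bounds for the past, and a good next state *)

Section Step.
Variables (g : W2) (a : W2 -> P) (r : W2 -> state).
Hypothesis legal : forall e, e <= g -> ~ is_limit e -> I_legal a (fun e => (r e).1) e.
Hypothesis good : forall e, e < g -> good_state e a r (r e).

Let lower_bound (p : P) : Prop :=
  (forall e, e <= g -> ~ is_limit e -> ple p (a e)) /\
  (forall e, e < g -> ple p (r e).1).

Lemma next_move_le e x : e <= x -> x < g -> ple (a (succ x)) (r e).1.
Proof.
move=> ex xg; have xg' : succ x <= g by rewrite leS.
by apply: (legal xg' (@nonlimit_succ _ _ wo2 nm2 x) _).2; rewrite ltS.
Qed.

(** Cofinally many moves of I suffice: his move at [succ x] lies below II's moves up to [x], and
    these lie below his earlier moves. *)
Lemma lower_bound_limit p : is_limit g ->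
  (forall e, e < g -> exists x, [/\ e <= x, x < g & ple p (a (succ x))]) ->
  lower_bound p.
Proof.
move=> lg pa; have pr e : e < g -> ple p (r e).1.
  move=> eg; have [x [ex xg px]] := pa e eg.
  by apply: ple_trans px _; exact: next_move_le.
split=> // e; rewrite le_eqVlt => /orP[/eqP -> //|eg] nl.
by apply: ple_trans (pr e eg) _; have [+ _ _ _] := good eg; apply.
Qed.

(** Between two successive listed turns [e' < e] stands II's real move at [e']: it is below the
    star-answer at [e'] and above the next attached move, made at [e]. *)
Lemma history_legal s : path >%O g s -> legal_list t o (history r s).
Proof.
move: good; elim: s g => // e s IH g' gd /= /andP[eg es].
have gd' : forall e', e' < e -> good_state e' a r (r e').
  by move=> e' e'e; apply: gd; exact: lt_trans eg.
split; first exact: IH es.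
case: s es {IH} => // e' s' es _.
have [_ _ /(_ _ es)[/(_ _ _ erefl) ce' _] _] := gd _ eg.
apply: ple_trans ce' _; move: es => /= /andP[e'e es'].
by have [_ _ /(_ _ es')[_ re'] _] := gd' _ e'e.
Qed.

(** Along an increasing omega-sequence cofinal in [g], the attached finite plays form one play of
    length omega, interleaved with II's real moves. Its limit bounds them all. *)
Lemma lower_bound_S20 : S20 g -> exists p, lower_bound p.
Proof.
move=> Sg; have lg := S20_limit hW1 hW2 Sg.
have [u [ug uS ucof]] := cofinal_seq hW1 hW2 lg (z_cofinal Sg).
(* [s n] lists the first [n] terms of the sequence, latest first. *)
pose s := fix s n := if n is m.+1 then u m :: s m else [::].
have sP n : path >%O (u n) (s n).
  elim: n => // n IH /=; rewrite uS /=; case: n IH => // n /=.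
pose c n := (r (u n)).2 (s n).
have sPg n : path >%O g (s n).
  by case: n => // n /=; rewrite ug; exact: sP.
have [||n|p pc] := @list_move_lim _ _ hW1 _ _ tw _ o_least (fun n => history r (s n)) c.
- by [].
- by [].
- have [_ _ /(_ _ (sP n.+1))[/(_ _ _ erefl) h1 _] _] := good (ug n.+1).
  apply: ple_trans h1 _.
  by have [_ _ /(_ _ (sP n))[_ h2] _] := good (ug n).
have pr n : ple p (r (u n)).1.
  apply: ple_trans (pc n.+1) _.
  by have [_ _ /(_ _ (sP n.+1))[/(_ _ _ erefl) h1 _] _] := good (ug n.+1).
have pr' e : e < g -> ple p (r e).1.
  move=> /ucof[n]; rewrite le_eqVlt => /orP[/eqP ->//|eu].
  by apply: ple_trans (pr n) _; have [_ + _ _] := good (ug n); apply.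
exists p; split=> // e; rewrite le_eqVlt => /orP[/eqP -> //|eg] nl.
by apply: ple_trans (pr' e eg) _; have [+ _ _ _] := good eg; apply.
Qed.

(** The sets [past_moves a (h c)], with [h] enumerating the club, form a legal play in which II's
    answers are those given by [t]. The common extension at the end of the play is the bound. *)
Lemma lower_bound_S21 : S21 W1 g -> exists p, lower_bound p.
Proof.
move=> Sg; have lg := S21_limit hW1 hW2 Sg.
have [C [CS Cclub [h [hm hC]] [zmono zcont]] fC] := z_club Sg.
have {}hm x y : (x < y) = (h x < h y) by exact: hm.
have Ch x : C (h x) by rewrite -hC; exists x.
have Cg x : h x < g by exact: Cclub.1.1.
have hle x y : x <= y -> h x <= h y.
  by rewrite le_eqVlt => /orP[/eqP ->|] //; rewrite hm => /ltW.
pose B c := past_moves a (h c).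
have Bmono c c' : c <= c' -> B c `<=` B c'.
  move=> /hle cc' _ [x zx <-]; exists x => //.
  exact: zmono (Ch c) (Ch c') cc' _ zx.
have zlt c x : z (h c) x -> x < h c by move=> /(z_cofinal (CS _ (Ch c))).2.1.
have Bplus c : countable_plus (B c).
  have Sc := CS _ (Ch c).
  split.
  - have [x zx] := cofinal_nonempty (S20_limit hW1 hW2 Sc) (z_cofinal Sc).2.
    by exists (a (succ x)), x.
  - exact: sub_countable (card_image_le _ _) (z_cofinal Sc).1.
  - exists (r (h c)).1 => _ [x zx <-]; have [+ _ _ _] := good (Cg c); apply.
      by rewrite leS //; exact: zlt.
    exact: nonlimit_succ.
(* The enumeration is continuous: the supremum of the earlier members is a limit point of [C], so it
   belongs to [C] and can only be [h c]. *)
have hlim c : is_limit c -> limit_point C (h c).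
  move=> [[c0 c0c] cl].
  have [s sP] : exists s, cofinal_in (h @` below c) s.
    by apply: cofinal_exists => //; exists (h c) => _ [x xc <-]; rewrite -hm.
  have sl b : b < s -> exists2 x, x < c & b < h x.
    move=> /sP.2[_ [x xc <-] bx]; have [x' [xx' x'c]] := cl x xc.
    by exists x' => //; apply: le_lt_trans bx _; rewrite -hm.
  have hs x : x < c -> h x < s by move=> xc; apply: sP.1; exists x.
  have lps : limit_point C s.
    split.
      split; first by exists (h c0); exact: hs.
      by move=> b /sl[x xc bx]; exists (h x); split=> //; exact: hs.
    by move=> b /sl[x xc bx]; exists (h x); split=> //; exact: hs.
  suff -> : h c = s by [].
  apply/eqP; rewrite eq_le; apply/andP; split; last first.
    rewrite leNgt; apply/negP => /sl[x xc]; rewrite -hm => cx.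
    by have := lt_trans xc cx; rewrite ltxx.
  rewrite leNgt; apply/negP => shc.
  have := Cclub.2 s (lt_trans shc (Cg c)) lps; rewrite -hC => -[y _ ys].
  by move: shc; rewrite -ys -hm => /hs; rewrite ys ltxx.
(* At limits this is the continuity of [z] along [C]. An element coming from turn [e] is moved to
   [succ e], because only non-limit turns enter the union. *)
have SB c : star_set B c = B c.
  rewrite /star_set; case: asboolP => // lc; apply/seteqP; split=> p.
    by move=> [e [ec _]]; apply: Bmono; exact: ltW.
  move=> [x + <-]; rewrite (zcont _ (Ch c) (hlim _ lc)) => -[b []].
  rewrite -{1}hC => -[e _ <-] /=; rewrite /below/= -hm => ec zx.
  exists (succ e); first by split; [exact: limit_succ|exact: nonlimit_succ].
  exists x => //; apply: zmono zx => //; apply: hle; exact/ltW/lt_succ.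
have legB c : (forall e, e < c -> common_extension (B e) (t e (B e))) ->
    ~ is_limit c -> star_I_legal B (fun e => t e (star_set B e)) c.
  move=> IH nl; split; first exact: Bplus.
    by move=> e ec _; apply: Bmono; exact: ltW.
  move=> e /(is_succE wo1 nm1) cE; have ec : e < c by rewrite cE lt_succ.
  (* Since [z (h c)] is cofinal in [h c], it has an element [x] at or above [h e]. I's move at
     [succ x] then lies in [B c] and below II's move at [h e], hence below the star-answer
     [t e (B e)]. *)
  have [x zx ex] := (z_cofinal (CS _ (Ch c))).2.2 (h e) (etrans (esym (hm e c)) ec).
  have xg : x < g by exact: lt_trans (zlt _ _ zx) (Cg c).
  have ax : ple (a (succ x)) (t e (B e)).
    apply: ple_trans (next_move_le ex xg) _.
    have tE : limit_move a (h e) = t e (B e).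
      apply: t_phi; first exact: Bplus.
      have <- : f (h e) = phi e.
        by apply: fC => //; rewrite -hC; exact: order_type_range.
      apply: (@pick_inP _ o [set k | phi k = f (h e)]); exists e => /=.
      by symmetry; apply: fC => //; rewrite -hC; exact: order_type_range.
    rewrite -tE; have [_ _ _] := good (Cg e); apply; first exact: CS.
    by rewrite tE; exact: IH.
  move=> p pB; rewrite SB.
  have /= pe : bc_set (bc_embed (a (succ x))) p.
    by apply: (pB (bc_embed (a (succ x)))); exists (a (succ x)) => //; exists x.
  by move=> q /pe[s [sq sx]]; exists s; split=> //; exact: ple_trans sx ax.
have CE c : common_extension (B c) (t c (B c)).
  move: c; apply: (wo_ind wo1) => c IH.
  have [/(_ c) + _] := tw B; rewrite SB; apply=> e ec nl; apply: legB => // e' e'e.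
  by apply: IH; exact: lt_le_trans ec.
have [_ []] := tw B; first by move=> e nl; apply: legB.
move=> p pB; exists p; apply: lower_bound_limit => // e eg.
have [y + ec] := Cclub.1.2 e eg; rewrite -{1}hC => -[c _ hc]; subst y.
have cc : h c < h (succ c) by rewrite -hm lt_succ.
have [x zx cx] := (z_cofinal (CS _ (Ch (succ c)))).2.2 _ cc.
exists x; split; [exact: le_trans ec cx|exact: lt_trans (zlt _ _ zx) (Cg _)|].
apply: pB; exists (succ c); first exact: nonlimit_succ.
by exists x.
Qed.

(** At a non-limit turn I's own move serves. At cofinality omega it is [limit_move] when that is
    legal, and otherwise the bound from the attached finite plays; at cofinality omega_1 it is the
    bound from the club. *)
Lemma good_start : exists2 p, lower_bound p &
  S20 g -> common_extension (past_moves a g) (limit_move a g) ->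
  ple p (limit_move a g).
Proof.
have [lg|nl] := pselect (is_limit g); last first.
  exists (a g); last by move=> /(S20_limit hW1 hW2).
  split=> e; last by move=> /(legal (lexx g) nl)[].
  rewrite le_eqVlt => /orP[/eqP -> _|eg]; first exact: ple_refl.
  exact: (legal (lexx g) nl eg).1.
have [Sg|Sg] := limit_S20_S21 hW1 hW2 lg; last first.
  have [p pP] := lower_bound_S21 Sg.
  by exists p => // Sg'; case: (S21_S20 hW1 Sg Sg').
have [ce|nce] := pselect (common_extension (past_moves a g) (limit_move a g)).
  exists (limit_move a g) => [|_ _]; last exact: ple_refl.
  apply: lower_bound_limit => // e eg.
  have [x zx ex] := (z_cofinal Sg).2.2 e eg; exists x; split=> //.
    exact: (z_cofinal Sg).2.1.
  by apply: ce; exists x.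
by have [p pP] := lower_bound_S20 Sg; exists p.
Qed.

Lemma good_state_exists : exists x, good_state g a r x.
Proof.
have [p [pa pr] pl] := good_start.
have hcard : [set s | path >%O g s] #<= [set: W1].
  apply: card_le_trans (below_seq_card hW1 hW2 g); apply: subset_card_le => s.
  exact: path_gt_lt.
have [idx idxP] := card_le_surj [::] hcard.
(* Below [p] these sets are open and dense: a condition [q] is itself taken as the next move in the
   play attached to [s], and the star-answer to it lies below [q]. There are at most aleph_1 lists
   [s], so [star_baire] meets all of them at once. *)
pose D s := [set q : P | path >%O g s -> exists2 c,
  (forall e s', s = e :: s' -> ple c (r e).1) &
  ple q (list_move t o (c :: history r s))].
have [|e q q' qD q'q|b bp bD] := @star_baire _ _ hW1 _ _ tw (D \o idx) p.
- move=> e q qp /=; have [gs|ngs] := pselect (path >%O g (idx e)); last first.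
    by exists q; [move=> /ngs|exact: ple_refl].
  have qr : forall e' s', idx e = e' :: s' -> ple q (r e').1.
    move=> e' s' eE; apply: ple_trans qp (pr _ _); apply: (path_gt_lt gs).
    by rewrite eE mem_head.
  exists (list_move t o (q :: history r (idx e))).
    by move=> _; exists q => //; exact: ple_refl.
  apply: list_move_le => //=; split; first exact: history_legal.
  case E : (idx e) gs => [|e' s'] //= /andP[e'g es'] _.
  apply: ple_trans (qr _ _ E) _.
  by have [_ _ /(_ _ es')[]] := good e'g.
- by move=> /qD[c ce cq]; exists c => //; exact: ple_trans q'q cq.
pose c s := pick_in p [set c | (forall e s', s = e :: s' -> ple c (r e).1) /\
  ple b (list_move t o (c :: history r s))].
exists (b, c); split=> /=.
- by move=> e eg nl; apply: ple_trans bp _; exact: pa.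
- by move=> e eg; apply: ple_trans bp _; exact: pr.
- move=> s gs; apply: (@pick_inP _ p [set c |
    (forall e s', s = e :: s' -> ple c (r e).1) /\
    ple b (list_move t o (c :: history r s))]).
  have [e _ eE] := idxP s gs; have := bD e; rewrite /= eE => /(_ gs)[c' h1 h2].
  by exists c'.
- by move=> Sg ce; apply: ple_trans bp _; exact: pl.
Qed.

End Step.

Lemma clocked_strategically_closed : strategically_closed P W2.
Proof.
pose x0 : state := (pone, fun=> pone).
pose trunc (g : W2) (a : W2 -> P) e := if `[< e <= g /\ ~ is_limit e >] then a e else pone.
(* The recursion produces functions of I's entire sequence, so that a state can refer to earlier
   states for the same sequence; [trunc] hides the moves that the strategy may not see. *)
have [R RE] := wo_rec wo2 (fun _ : W2 -> P => x0) (fun g h a =>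
  pick_in x0 (good_state g (trunc g a) (fun e => h e a))).
have {}RE c a : R c a = pick_in x0 (good_state c (trunc c a)
    (fun e => (if e < c then R e else fun=> x0) a)).
  exact: (congr1 (@^~ a) (RE c)).
exists (fun c a => (R c a).1).
  move=> c a a' aa'; congr (_.1); move: c aa'; apply: (wo_ind wo2) => c IH aa'.
  rewrite !RE; congr (pick_in _ (good_state _ _ _)).
    by apply/funext => e; rewrite /trunc; case: asboolP => // -[ec nl]; exact: aa'.
  apply/funext => e; case: ifPn => // ec; apply: IH => // b be nl; apply: aa' => //.
  exact: le_trans be (ltW ec).
move=> a b c legal.
suff [h1 h2 _ _] : good_state c a (R^~ a) (R c a) by split=> // e; exact: h2.
move: c legal; apply: (wo_ind wo2) => c IH legal.
have [x xP] : exists x, good_state c a (R^~ a) x.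
  apply: good_state_exists => // e ec; apply: IH => // e' e'e.
  by apply: legal; exact: le_trans e'e (ltW ec).
have aT e : e <= c -> ~ is_limit e -> a e = trunc c a e.
  by move=> ec nl; rewrite /trunc; case: asboolP => // -[].
have rT e : e < c -> R e a = (if e < c then R e else fun=> x0) a by move=> ->.
apply: (@good_state_ext c (trunc c a) a (fun e => (if e < c then R e else fun=> x0) a)).
- by move=> e ec nl; rewrite -aT.
- by move=> e ec; rewrite -rT.
rewrite [R c a]RE.
by apply: pick_inP; exists x; exact: good_state_ext xP.
Qed.

End Strategy.

(** * The posets of end-extensions *)

(** The condition [q] lies in the meet, hence in the regular open set of [b], so everything below
    [q] is compatible with [b]. By separativity [q] is below [b]. *)
Lemma bc_inf_le (P : poset) (A : set P) b q : separative P ->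
  bc_le (bc_inf [set bc_embed p | p in A]) (bc_embed b) ->
  common_extension A q -> ple q b.
Proof.
move=> sep Ab qA; apply: contrapT => /sep[r [rq nrb]]; apply: nrb.
have : bc_set (bc_embed b) q; last by apply.
apply: Ab => _ [p Ap <-] s sq; exists s; split; first exact: ple_refl.
exact: ple_trans sq (qA p Ap).
Qed.

Section EndExtension.
Context {d1 d2 : Order.disp_t} {W1 : orderType d1} {W2 : orderType d2}.
Hypothesis hW1 : is_omega1 W1.
Hypothesis hW2 : is_omega2 W1 W2.
Context {Y : Type} (phi : W1 -> Y).

Let wo1 : well_order (<=%O : rel W1). Proof. by case: hW1. Qed.
Let wo2 : well_order (<=%O : rel W2). Proof. by case: hW2. Qed.
Let nm1 : forall a : W1, exists b, a < b. Proof. exact: nomax1. Qed.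
Let nm2 : forall a : W2, exists b, a < b. Proof. exact: (nomax2 hW1 hW2). Qed.

Definition club_at (v : W2 -> set W2 * Y) (b : W2) : Prop :=
  clocked_club phi (fun a => (v a).1) (fun a => (v a).2) b.

Lemma club_at_ext v v' b : (forall a, a < b -> v a = v' a) ->
  club_at v b -> club_at v' b.
Proof.
move=> vv' [C [CS Cb Co [zm zc]] fC].
have CE a : C a -> v a = v' a by move=> /Cb.1.1; exact: vv'.
exists C; last by move=> a c Ca; rewrite -CE //; exact: fC.
split=> //; split=> [a c Ca Cc|a Ca la]; first by rewrite -!CE //; exact: zm.
by rewrite -CE // zc //; apply: eq_bigcupr => c [Cc _]; rewrite CE.
Qed.

(** The common form of the conditions of both posets, with both sequences packed into [v]. The two
    concrete types of conditions enter below only through [K_valid] and [K_mk]. *)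
Definition valid (s : W2) (v : W2 -> set W2 * Y) : Prop :=
  [/\ S20 s,
      forall a, a <= s -> ~ S20 a -> (v a).1 = set0,
      forall a, a <= s -> S20 a -> countable_cofinal (v a).1 a
    & forall b, S21 W1 b -> b < s -> club_at v b].

Variables (K : Type) (top : K -> W2) (val : K -> W2 -> set W2 * Y).
Variable leK : K -> K -> Prop.
Hypothesis leK_refl : forall p, leK p p.
Hypothesis leK_trans : forall p q r, leK p q -> leK q r -> leK p r.
Hypothesis leKP : forall p q, leK p q <->
  top q <= top p /\ forall a, a <= top q -> val q a = val p a.
Hypothesis K_valid : forall k, valid (top k) (val k).
Hypothesis K_mk : forall s v, valid s v ->
  exists k, top k = s /\ forall a, a <= s -> val k a = v a.

Let P : poset := Poset (with_top_refl leK_refl) (with_top_trans leK_trans)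
  (@with_top_none _ leK).

Variables (o1 : W1) (o2 : W2).
Hypothesis o2_least : forall a, o2 <= a.

Definition otop (p : option K) : W2 := if p is Some k then top k else o2.

(** Adding the finite translates makes the supremum a limit strictly above every top, even when the
    tops have a maximum. *)
Definition blocks (A : set (option K)) : set W2 := \bigcup_(p in A) block (otop p).

Definition agreeing (A : set (option K)) : Prop := forall k l a,
  A (Some k) -> A (Some l) -> a <= top k -> a <= top l -> val k a = val l a.

Definition glue (A : set (option K)) (a : W2) : set W2 * Y :=
  pick_in (set0, phi o1)
    [set x | exists k, [/\ A (Some k), a <= top k & x = val k a]].

Lemma glueE A k a : agreeing A -> A (Some k) -> a <= top k -> glue A a = val k a.
Proof.
move=> Aa Ak ak; rewrite /glue; set D := [set x | _].
have /(pick_inP (set0, phi o1))[l [Al al ->]] : D !=set0 by exists (val k a), k.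
exact: Aa.
Qed.

Lemma common_extension_agreeing (A : set P) q : common_extension A q -> agreeing A.
Proof.
move=> qA k l a Ak Al ak al; case: q qA => [m|] qA; last by case: (qA _ Ak).
have /leKP[_ h1] := qA _ Ak; have /leKP[_ h2] := qA _ Al.
by rewrite h1 // h2.
Qed.

Lemma top_limit k : is_limit (top k).
Proof. by have [/(S20_limit hW1 hW2)] := K_valid k. Qed.

Lemma blocks_mono (A B : set (option K)) : A `<=` B -> blocks A `<=` blocks B.
Proof. by move=> AB x [p /AB Bp px]; exists p. Qed.

Lemma blocks_nonempty A : A !=set0 -> blocks A !=set0.
Proof. by move=> [p Ap]; exists (otop p), p => //; exact: block_self. Qed.

Lemma blocks_limit A s : A !=set0 -> cofinal_in (blocks A) s -> is_limit s.
Proof.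
move=> A0; apply: cofinal_limit => //; first exact: blocks_nonempty.
by move=> x [p Ap px]; exists p => //; exact: block_succ.
Qed.

Lemma below_blocks A s a : cofinal_in (blocks A) s -> is_limit a -> a < s ->
  exists2 k, A (Some k) & a <= top k.
Proof.
move=> [_ sA] la /sA[x [p Ap px] ax].
have ap := block_limit wo2 nm2 la px ax.
case: p Ap px ap => [k|] Ap _ /= ap; first by exists k.
by case: la => -[b ba] _; move: (lt_le_trans ba ap); rewrite ltNge o2_least.
Qed.

Lemma top_lt_blocks A s k : cofinal_in (blocks A) s -> A (Some k) -> top k < s.
Proof. by move=> [As _] Ak; apply: As; exists (Some k) => //; exact: block_self. Qed.

(** The new condition is the union of [A] below [s], carries [(z0, y)] at its top [u], and is
    arbitrary in between. The case [s < u] is for a union whose height [s] has cofinality omega_1,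
    where a club must be supplied. *)
Lemma amalgam A s u z0 y : agreeing A -> A !=set0 -> cofinal_in (blocks A) s ->
  s <= u -> S20 u -> countable_cofinal z0 u ->
  (forall b, S21 W1 b -> s < b -> b < u -> False) ->
  (S21 W1 s -> s < u -> club_at (glue A) s) ->
  exists k, [/\ top k = u, val k u = (z0, y)
    & common_extension (A : set P) (Some k)].
Proof.
move=> Aa A0 sA su Su zu nob sclub.
pose v a := if a < s then glue A a else if a == u then (z0, y)
  else (if `[< S20 a >] then pick_in set0 [set B | countable_cofinal B a] else set0, y).
have vglue a : a < s -> v a = glue A a by rewrite /v => ->.
have [k [ku kv]] : exists k, top k = u /\ forall a, a <= u -> val k a = v a.
  apply: K_mk; split=> //.
  - move=> a au nSa; rewrite /v; case: ifPn => [as_|_].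
      have [[k [Ak ak]]|nk] := pselect (exists k, A (Some k) /\ a <= top k).
        by rewrite (glueE Aa Ak ak); have [_ h _ _] := K_valid k; exact: h.
      by rewrite /glue pick_in0 // => -[_ [k [Ak ak _]]]; case: nk; exists k.
    by case: eqP => [aE|_] /=; [case: nSa; rewrite aE|case: asboolP].
  - move=> a au Sa; rewrite /v; case: ifPn => [as_|_].
      have [k Ak ak] := below_blocks sA (S20_limit hW1 hW2 Sa) as_.
      by rewrite (glueE Aa Ak ak); have [_ _ h _] := K_valid k; exact: h.
    case: eqP => [->//|_] /=; case: asboolP => // _.
    by apply: (@pick_inP _ set0 [set B | countable_cofinal B a]); exact: S20_cofinal.
  - move=> b Sb bu; have [bs|sb|bs] := ltgtP b s.
    + have lb := S21_limit hW1 hW2 Sb.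
      have [k Ak bk] := below_blocks sA lb bs.
      have bk' : b < top k.
        move: bk; rewrite le_eqVlt => /orP[/eqP bk|//].
        by case: (S21_S20 hW1 Sb); rewrite bk; case: (K_valid k).
      apply: (@club_at_ext (val k)); last by have [_ _ _ h] := K_valid k; exact: h.
      move=> a ab; rewrite vglue ?(glueE Aa Ak) //; first exact/ltW/(lt_trans ab).
      exact: lt_trans bs.
    + by case: (nob b Sb sb bu).
    + subst b; apply: (@club_at_ext (glue A)); last exact: sclub.
      by move=> a /vglue ->.
exists k; split=> //; first by rewrite kv // /v ltNge su /= eqxx.
move=> [l|] // Al; apply/leKP; have ls := top_lt_blocks sA Al.
rewrite ku; split; first exact/ltW/(lt_le_trans ls).
move=> a al; have as_ := le_lt_trans al ls.
rewrite kv; last exact/ltW/(lt_le_trans as_).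
by rewrite vglue // (glueE Aa Al).
Qed.

Lemma countable_amalgam A : agreeing A -> A !=set0 -> countable A ->
  exists s, [/\ countable_cofinal (blocks A) s, is_limit s
    & forall z0 y, countable_cofinal z0 s ->
      exists k, [/\ top k = s, val k s = (z0, y)
        & common_extension (A : set P) (Some k)]].
Proof.
move=> Aa A0 cA.
have cZ : countable (blocks A).
  by apply: bigcup_countable => // p _; exact: countable_block.
have [s sA] : exists s, cofinal_in (blocks A) s.
  apply: cofinal_exists => //; apply: (bounded2 hW1 hW2).
  exact: countable_le_omega1 hW1 _ _ cZ.
have ls := blocks_limit A0 sA.
exists s; split=> // z0 y z0s; apply: (amalgam (s := s)) => //.
- exact: S20_intro sA.
- by move=> b _ sb bs; have := lt_trans sb bs; rewrite ltxx.
- by rewrite ltxx.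
Qed.

(** If [p] and [Some l] disagree somewhere, [p] itself is incompatible with [Some l]. Otherwise [p]
    is shorter, and it is extended by omega with a top set different from the one in [l]. *)
Lemma end_extension_separative : separative P.
Proof.
move=> p [l|]; last by case: p => [k|] [].
have [pl|npl] := pselect (forall k a, p = Some k -> a <= top k -> a <= top l ->
    val k a = val l a); last first.
  move=> _; have {npl} [k [a [pk ak al kl]]] : exists k a,
      [/\ p = Some k, a <= top k, a <= top l & val k a <> val l a].
    apply: contrapT => h; apply: npl => k a pk ak al; apply: contrapT => kl.
    by apply: h; exists k, a.
  exists p; split=> [|[[m|] []]]; [exact: ple_refl| |by rewrite pk].
  rewrite pk => /leKP[_ h1] /leKP[_ h2]; apply: kl.
  by rewrite h1 // h2.
move=> nple.
have ptl : otop p < top l.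
  case: p pl nple => [k|] pl nple /=; last first.
    by have [[b bl] _] := top_limit l; exact: le_lt_trans (o2_least b) bl.
  rewrite ltNge; apply/negP => lk; apply: nple; apply/leKP; split=> // a al.
  by symmetry; apply: pl => //; exact: le_trans lk.
have [||s [Zs ls sk]] := @countable_amalgam [set p] _ _ (countable1 p).
- by move=> k m a /= <- [->].
- by exists p.
have [z0 z0s z0l] := cofinal_other (val l s).1 ls Zs.
have [k [ks kv kA]] := sk z0 (phi o1) z0s.
exists (Some k); split; first exact: kA.
have sl : s <= top l.
  rewrite leNgt; apply/negP => /Zs.2.2[x [_ -> px] lx].
  by have := block_lt wo2 nm2 (top_limit l) ptl px; rewrite ltNge lx.
move=> [[m|] []] // /leKP[_ h1] /leKP[_ h2].
have := h1 s; rewrite ks lexx kv => /(_ isT) kE.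
by apply: z0l; rewrite (h2 s sl) -kE.
Qed.

Definition SCP_operation : star_operation P W1 := fun c A =>
  pick_in None [set p | exists k, [/\ p = Some k, cofinal_in (blocks A) (top k),
    val k (top k) = (blocks A, phi c) & common_extension A p]].

Lemma SCP_operationP c (A : set P) : agreeing A -> A !=set0 -> countable A ->
  exists k, [/\ SCP_operation c A = Some k, cofinal_in (blocks A) (top k),
    val k (top k) = (blocks A, phi c) & common_extension A (Some k)].
Proof.
move=> Aa A0 cA; rewrite /SCP_operation; set D := [set p | _].
have /(pick_inP None)[k [-> h1 h2 h3]] : D !=set0; last by exists k.
have [s [Zs ls /(_ (blocks A) (phi c) Zs)[k [ks kv kA]]]] := countable_amalgam Aa A0 cA.
by exists (Some k), k; split; rewrite ?ks //; exact: Zs.2.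
Qed.

(** * A play in which II follows [SCP_operation] *)

Section Play.
Variable B : W1 -> set P.
Let b c := SCP_operation c (star_set B c).
Let legal e := ~ is_limit e -> star_I_legal B b e.

Lemma legal_mono e e' : legal e' -> ~ is_limit e -> ~ is_limit e' -> e <= e' ->
  B e `<=` B e'.
Proof.
move=> le' nl nl'; rewrite le_eqVlt => /orP[/eqP -> //|ee'].
by have [_ + _] := le' nl'; apply.
Qed.

Lemma star_setE c : (forall e, e <= c -> legal e) ->
  star_set B c = \bigcup_(e in [set e | e <= c /\ ~ is_limit e]) B e.
Proof.
move=> lc; rewrite /star_set; case: asboolP => [limc|nl].
  apply: eq_bigcupl; split=> e [ec nl]; split=> //; first exact: ltW.
  by move: ec; rewrite le_eqVlt => /orP[/eqP ec|//]; case: nl; rewrite ec.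
apply/seteqP; split=> p; first by move=> Bp; exists c.
by move=> [e [ec nle]]; apply: legal_mono => //; exact: lc.
Qed.

Lemma agreeing_bigcup (E : set W1) :
  (forall e, E e -> ~ is_limit e /\ legal e) -> agreeing (\bigcup_(e in E) B e).
Proof.
move=> EP k l a [e Ee Bk] [e' Ee' Bl].
have [nl le] := EP e Ee; have [nl' le'] := EP e' Ee'.
wlog ee' : k l e e' Ee Bk Ee' Bl nl le nl' le' / e <= e'.
  move=> H ak al; have [ee'|/ltW ee'] := leP e e'; first exact: (H k l e e').
  by symmetry; apply: (H l k e' e).
have [[_ _ [q /common_extension_agreeing h]] _ _] := le' nl'.
by apply: h => //; exact: legal_mono ee' _ Bk.
Qed.

Lemma star_set_agreeing c : (forall e, e <= c -> legal e) ->
  [/\ agreeing (star_set B c), star_set B c !=set0 & countable (star_set B c)].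
Proof.
move=> lc; rewrite (star_setE lc); split.
- by apply: agreeing_bigcup => e [ec nl]; split=> //; exact: lc.
- have [m m0] := least_exists wo1 (omega1_inh hW1).
  have nlm := least_nonlimit m0.
  have [[[p Bp] _ _] _ _] := lc m (m0 c) nlm.
  by exists p, m => //; split=> //; exact: m0.
- apply: bigcup_countable => [|e [ec nl]]; last by have [[]] := lc e ec nl.
  by apply: sub_countable (countable_le1 hW1 c); apply: subset_card_le => e [].
Qed.

Hypothesis all_legal : forall e, legal e.

(** The tops of II's moves form the club required at their supremum [s]. As [s] has cofinality
    omega_1 it cannot be a top, so the union is topped at [s] plus omega. *)
Lemma play_end : exists p,
  common_extension (\bigcup_(e in [set e | ~ is_limit e]) B e) p.
Proof.
have lc c : forall e, e <= c -> legal e by [].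
have /choice[k kP] : forall c, exists k, [/\ b c = Some k,
    cofinal_in (blocks (star_set B c)) (top k),
    val k (top k) = (blocks (star_set B c), phi c) &
    common_extension (star_set B c) (Some k)].
  by move=> c; have [h1 h2 h3] := star_set_agreeing (lc c); exact: SCP_operationP.
pose g c := top (k c).
have gE c : cofinal_in (blocks (star_set B c)) (g c) by case: (kP c).
have gS c : S20 (g c) by case: (K_valid (k c)).
have gl c : is_limit (g c) by exact: top_limit.
have Smono c c' : c <= c' -> star_set B c `<=` star_set B c'.
  move=> cc' p; rewrite !star_setE // => -[e [ec nl] Bp]; exists e => //.
  by split=> //; exact: le_trans cc'.
have stepB c q : common_extension (star_set B (succ c)) q -> ple q (Some (k c)).
  have nl := @nonlimit_succ _ _ wo1 nm1 c.
  have [_ _ /(_ _ (succP wo1 nm1 c))] := all_legal nl.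
  rewrite /star_set; case: asboolP => // _.
  have [-> _ _ _] := kP c.
  exact: bc_inf_le end_extension_separative.
have step c : leK (k (succ c)) (k c) by apply: (stepB c (Some _)); case: (kP (succ c)).
(* If the top did not grow, [A_{c+1}] would also have a common extension with the same top but
   another set there. I's rule puts every common extension of [A_{c+1}] below II's move at [c], a
   contradiction. *)
have gstep c : g c < g (succ c).
  have /leKP[] := step c; rewrite le_eqVlt => /orP[/eqP gg _|//]; exfalso.
  have [h1 h2 h3] := star_set_agreeing (lc (succ c)).
  have [s [Zs ls sk]] := countable_amalgam h1 h2 h3.
  have sE : s = g c by rewrite /g gg; exact: cofinal_uniq Zs.2 (gE (succ c)).
  subst s.
  have [z0 z0s z0l] := cofinal_other (val (k c) (g c)).1 ls Zs.
  have [k' [k's k'v /stepB/leKP[_ h]]] := sk z0 (phi o1) z0s.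
  by apply: z0l; rewrite h // k'v.
have glt c c' : c < c' -> g c < g c'.
  move=> cc'; apply: lt_le_trans (gstep c) _.
  have sc : succ c <= c' by rewrite leS.
  rewrite leNgt; apply/negP => /(gE (succ c)).2[x xS].
  by rewrite leNgt (gE c').1 //; exact: blocks_mono (Smono _ _ sc) _ xS.
have gm c c' : (c < c') = (g c < g c').
  apply/idP/idP; first exact: glt.
  move=> gg; rewrite ltNge; apply/negP; rewrite le_eqVlt => /orP[/eqP cc|/glt].
    by move: gg; rewrite cc ltxx.
  by rewrite ltNge (ltW gg).
set A := \bigcup_(e in _) B e.
have SA c : star_set B c `<=` A.
  by rewrite star_setE // => p [e [_ nl] Bp]; exists e.
have Aa : agreeing A by exact: agreeing_bigcup.
have A0 : A !=set0.
  by have [_ [p /SA Ap] _] := star_set_agreeing (lc o1); exists p.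
have [s sP] : exists s, cofinal_in (range g) s.
  have [m gm'] := range_bounded2 hW1 hW2 g.
  by apply: cofinal_exists => //; exists m => _ [c _ <-].
have gs c : g c < s by apply: sP.1; exists c.
have sA : cofinal_in (blocks A) s.
  split=> [x [p [e nl Bp] px]|x /sP.2[_ [c _ <-] xc]].
    apply: lt_trans (gs e); apply: (gE e).1; exists p => //.
    by rewrite star_setE //; exists e.
  have [y yS gy] := (gE (succ c)).2 _ (gstep c).
  by exists y; [exact: blocks_mono (SA _) _ yS|exact: le_trans gy].
have glueg c : glue A (g c) = (blocks (star_set B c), phi c).
  have [l Al gl'] := below_blocks (gE (succ c)) (gl c) (gstep c).
  rewrite (glueE Aa (SA _ _ Al) gl').
  have [_ _ _ /(_ _ Al)/leKP[_ ->//]] := kP (succ c).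
  have /leKP[_ <- //] := step c.
  by case: (kP c).
have ordg c := order_type_range c gm.
have sclub : club_at (glue A) s.
  exists (range g); last first.
    move=> _ e [c _ <-] he; rewrite glueg /=.
    by rewrite (order_type_uniq wo1 (ordg c) he).
  have limg c : limit_point (range g) (g c) -> is_limit c.
    move=> [lgc lp]; apply: contrapT => /(nonlimit_cases wo1 nm1)[c0|[e cE]].
      have [x xg] := lgc.1; have [_ [[e _ <-] _]] := lp x xg.
      by rewrite -gm ltNge c0.
    have ec : g e < g c by rewrite -gm cE lt_succ.
    have [_ [[e' _ <-] ee']] := lp (g e) ec.
    by rewrite -gm cE ltS // leNgt gm ee'.
  split.
  - by move=> _ [c _ <-].
  - split; first by split=> [_ [c _ <-]|]; [exact: gs|exact: sP.2].
    (* Closedness: a limit point [x] is [g c] for the least [c] with [x <= g c]. This [c] is a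
       limit, so every element of the blocks at [c] already occurs at an earlier turn and is below
       [x]. *)
    move=> x xs lx; have [_ [c0 _ <-] xc0] := sP.2 x xs.
    have [c xc cmin] := wo_least wo1 (ex_intro [set c | x <= g c] c0 xc0).
    have glx e : e < c -> g e < x.
      by move=> ec; rewrite ltNge; apply/negP => /cmin; rewrite leNgt ec.
    exists c => //; apply/eqP; rewrite eq_le xc andbT.
    have cl : is_limit c.
      apply: contrapT => /(nonlimit_cases wo1 nm1)[c0'|[e cE]].
        have [y yx] := lx.1.1; have [_ [[e _ <-] _ ex]] := lx.2 y yx.
        by have := lt_le_trans ex xc; rewrite -gm ltNge c0'.
      have [|_ [[e' _ <-] ee' e'x]] := lx.2 (g e); first by apply: glx; rewrite cE lt_succ.
      have := lt_le_trans e'x xc; rewrite -gm cE ltS // leNgt.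
      by rewrite gm ee'.
    rewrite leNgt; apply/negP => /(gE c).2[y [p + py]].
    rewrite star_setE // => -[e [ec nl] Bp].
    rewrite leNgt; case/negP; apply: lt_trans (glx e _); last first.
      by move: ec; rewrite le_eqVlt => /orP[/eqP ec|//]; case: nl; rewrite ec.
    by apply: (gE e).1; exists p => //; rewrite star_setE //; exists e.
  - by exists g; split=> [x y _ _|] //; exact: gm.
  - split=> [_ _ [c _ <-] [c' _ <-]|_ [c _ <-] /limg lc'].
      by rewrite leNgt -gm -leNgt !glueg => cc'; exact: blocks_mono (Smono _ _ cc').
    rewrite glueg /=; apply/seteqP; split=> [x [p + px]|x [_ [[e _ <-]]]].
      rewrite star_setE // => -[e [ec nl] Bp]; exists (g e).
        split; first by exists e.
        rewrite /below/= -gm.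
        by move: ec; rewrite le_eqVlt => /orP[/eqP ec|//]; case: nl; rewrite ec.
      by rewrite glueg; exists p => //; rewrite star_setE //; exists e.
    rewrite /below/= -gm glueg => /ltW ec; exact: blocks_mono (Smono _ _ ec) _.
(* [u] is [s] plus omega, so no limit lies strictly between [s] and [u]. *)
have [u uP] : exists u, cofinal_in (block s) u.
  apply: cofinal_exists => //; apply: (bounded2 hW1 hW2).
  by apply: (countable_le_omega1 hW1); exact: countable_block.
have lu : is_limit u.
  by apply: cofinal_limit uP => // [|x]; [exists s; exact: block_self|exact: block_succ].
have [q [_ _ qA]] : exists q, [/\ top q = u, val q u = (block s, phi o1)
    & common_extension (A : set P) (Some q)].
  apply: (amalgam (s := s)) => //.
  - by apply/ltW/uP.1; exact: block_self.
  - by apply: S20_intro uP => //; exact: countable_block.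
  - by split=> //; exact: countable_block.
  - move=> x Sx sx /uP.2[y ys xy].
    have := block_limit wo2 nm2 (S21_limit hW1 hW2 Sx) ys xy.
    by rewrite leNgt sx.
by exists (Some q).
Qed.

End Play.

Lemma end_extension_closed : clocked_closed phi P.
Proof.
exists SCP_operation; last by move=> c c' A _ cc'; rewrite /SCP_operation cc'.
move=> B; split=> [c legal|]; last exact: play_end.
have [h1 h2 h3] := star_set_agreeing legal.
by have [k [-> _ _]] := SCP_operationP c h1 h2 h3.
Qed.

(** By induction the sets for the at most aleph_1 smaller heights are open and dense, so one
    condition [q] lies in all of them. Topping it by omega more reaches [b]. *)
Lemma end_extension_dense b : dense [set p : P | exists2 k, p = Some k & b <= top k].
Proof.
move: b; apply: (wo_ind wo2) => b IH p.
have [t tw _] := end_extension_closed.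
have [i iP] : exists i : W1 -> W2, forall e, e < b -> exists2 c, True & i c = e.
  have lb : below b #<= [set: W1] by case: hW2 => _ _; exact.
  by have [i iP] := card_le_surj o2 lb; exists i => e /iP[c _ <-]; exists c.
(* The enumeration [i] of [below b] may also take values outside it, hence the guard [i c < b]. *)
have [||q qp qD] := @star_baire _ _ hW1 P t tw (fun c => [set q | i c < b ->
    exists2 k, q = Some k & i c <= top k]) p.
- move=> c q qp; have [ib|] := pselect (i c < b); last by exists q => //; exact: ple_refl.
  by have [r rD rq] := IH _ ib q; exists r.
- move=> c q [r|] qD rq ib; last by have [k qE] := qD ib; move: rq; rewrite qE.
  exists r => //; have [k qE ik] := qD ib; move: rq; rewrite qE => /leKP[kr _].
  exact: le_trans kr.
have [||s [Zs ls sk]] := @countable_amalgam [set q] _ _ (countable1 q).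
- by move=> k m a /= <- [->].
- by exists q.
have [k [ks _ kA]] := sk _ (phi o1) Zs.
exists (Some k); last by apply: ple_trans qp; exact: kA.
exists k => //; rewrite ks leNgt; apply/negP => sb.
have [c _ ic] := iP _ sb; have := qD c; rewrite /= ic => /(_ sb)[m qE sm].
by have := top_lt_blocks Zs.2 (esym qE : [set q] (Some m)); rewrite ltNge sm.
Qed.

(** A filter containing conditions of every height is directed, so its union is well defined. The
    club at [b] is read off a condition whose top lies above [b]. *)
Lemma end_extension_MA_SCP : MA P W2 -> clocked_SCP (W2 := W2) phi.
Proof.
move=> ma.
have [|_ [b _ <-]|F [_ _ Fdir] FD] := ma
    (range (fun b => [set p : P | exists2 k, p = Some k & b <= top k])).
- exact: card_image_le.
- exact: end_extension_dense.
have Fk b : exists k, F (Some k) /\ b <= top k.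
  have [|_ [[k -> bk] Fk]] := FD [set p : P | exists2 k, p = Some k & b <= top k].
    by exists b.
  by exists k.
have Fa : agreeing F.
  move=> k l a Fk' Fl ak al; have [r [_ rk rl]] := Fdir _ _ Fk' Fl.
  apply: (@common_extension_agreeing [set Some k; Some l] r) => //.
  - by move=> _ [->|->].
  - by left.
  - by right.
exists (fun a => (glue F a).1), (fun a => (glue F a).2); split=> [a Sa|b Sb].
  have [k [Fk' ak]] := Fk a; rewrite (glueE Fa Fk' ak).
  by have [_ _ h _] := K_valid k; exact: h.
have [k [Fk' bk]] := Fk (succ b); have bk' : b < top k by rewrite -(leS wo2 nm2).
apply: (@club_at_ext (val k)); last by have [_ _ _ h] := K_valid k; exact: h.
by move=> a ab; rewrite (glueE Fa Fk') // ltW // (lt_trans ab).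
Qed.

End EndExtension.

(** * The equivalence for a general clock *)

Section Equivalence.
Context {d1 d2 : Order.disp_t} {W1 : orderType d1} {W2 : orderType d2}.
Hypothesis hW1 : is_omega1 W1.
Hypothesis hW2 : is_omega2 W1 W2.
Context {Y : Type} (phi : W1 -> Y).
Variables (K : Type) (top : K -> W2) (val : K -> W2 -> set W2 * Y).
Variable leK : K -> K -> Prop.
Hypothesis leK_refl : forall p, leK p p.
Hypothesis leK_trans : forall p q r, leK p q -> leK q r -> leK p r.
Hypothesis leKP : forall p q, leK p q <->
  top q <= top p /\ forall a, a <= top q -> val q a = val p a.
Hypothesis K_valid : forall k, valid phi (top k) (val k).
Hypothesis K_mk : forall s v, valid phi s v ->
  exists k, top k = s /\ forall a, a <= s -> val k a = v a.
Variables (scp : Prop) (cl : poset -> Prop).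
Hypothesis scpP : scp <-> clocked_SCP (W2 := W2) phi.
Hypothesis clP : forall P, cl P <-> clocked_closed phi P.

Let P := Poset (with_top_refl leK_refl) (with_top_trans leK_trans)
  (@with_top_none _ leK).

Lemma clocked_equivalence :
  [<-> scp;
       forall Q : poset, separative Q -> cl Q -> strategically_closed Q W2;
       strategically_closed P W2;
       forall Q : poset, separative Q -> cl Q -> MA Q W2;
       MA P W2].
Proof.
have [wo1 _ _] := hW1; have [wo2 _ _] := hW2.
have [o1 o1_least] := least_exists wo1 (omega1_inh hW1).
have [o2 o2_least] := least_exists wo2 (omega2_inh hW2).
have sepP : separative P.
  exact: (end_extension_separative hW1 hW2 leKP K_valid K_mk o1 o2_least).
have clPP : cl P.
  apply/clP; exact: (end_extension_closed hW1 hW2 leK_refl leK_trans leKP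
    K_valid K_mk o1 o2_least).
have MA_scp : MA P W2 -> clocked_SCP (W2 := W2) phi.
  exact: (end_extension_MA_SCP hW1 hW2 leKP K_valid K_mk o1 o2_least).
have sc : clocked_SCP (W2 := W2) phi -> forall Q, cl Q -> strategically_closed Q W2.
  move=> [z [f [zc zb]]] Q /clP[t tw tphi].
  exact: (clocked_strategically_closed hW1 hW2 zc zb tw tphi o1_least).
have ma Q : strategically_closed Q W2 -> MA Q W2.
  exact: strategically_closed_MA wo2 (nomax2 hW1 hW2) (omega2_inh hW2).
tfae.
- by move=> /scpP/sc h Q _; exact: h.
- by apply.
(* From the single poset back to all posets: strategic closedness of [P] gives MA for [P], hence the
   square-like principle, hence strategic closedness of every closed poset. *)
- by move=> /ma/MA_scp/sc h Q _ /h/ma.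
- by apply.
- by move=> /MA_scp/scpP.
Qed.

End Equivalence.

(** * The two clocks: the identity and the constant *)

Section Instances.
Context {d1 d2 : Order.disp_t} {W1 : orderType d1} {W2 : orderType d2}.
Hypothesis hW1 : is_omega1 W1.

(** Each member of [C] has an index in the enumeration of [C] by [W1], and this index is the only
    ordinal with the required order type. *)
Lemma clocked_club_id z (f : W2 -> W1) b : clocked_club id z f b <->
  exists2 C, climbing_club W1 z b C & counts_club f C.
Proof.
have [wo1 _ _] := hW1; split=> -[C Cc fC]; exists C => //.
  case: (Cc) => _ _ [h [hm hC]] _ a Ca.
  have [c _ ca] : (h @` [set: W1]) a by rewrite hC.
  have cE : same_order_type (below c) (C `&` below a).
    by rewrite -hC -ca; apply: order_type_range => x y; exact: hm.
  by rewrite (fC a c).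
by move=> a c /fC fa ca; exact: order_type_uniq wo1 fa ca.
Qed.

Lemma clocked_club_unit z (f : W2 -> unit) b :
  clocked_club (fun _ : W1 => tt) z f b <-> exists C, climbing_club W1 z b C.
Proof.
split=> [[C Cc _]|[C Cc]]; exists C => // a c _ _; by case: (f a).
Qed.

Lemma clocked_SCP_id : SCP W1 W2 <-> clocked_SCP (W2 := W2) (@id W1).
Proof.
by split=> -[z [f [zc zb]]]; exists z, f; split=> // b /zb/clocked_club_id.
Qed.

Lemma clocked_SCP_unit : SCPm W1 W2 <-> clocked_SCP (W2 := W2) (fun _ : W1 => tt).
Proof.
split=> [[z [zc zb]]|[z [f [zc zb]]]].
  by exists z, (fun=> tt); split=> // b /zb/(clocked_club_unit _ (fun=> tt)).
by exists z; split=> // b /zb/clocked_club_unit.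
Qed.

Lemma clocked_closed_id (P : poset) :
  star_operationally_closed P W1 <-> clocked_closed (@id W1) P.
Proof.
split=> [[t tw]|[t tw _]]; last by exists t.
by exists t => // c c' A _ ->.
Qed.

Lemma clocked_closed_unit (P : poset) :
  star_tactically_closed P W1 <-> clocked_closed (fun _ : W1 => tt) P.
Proof.
split=> -[t]; first by move=> tt tw; exists t => // c c' A /tt.
by move=> tw tE; exists t => // c c' A /tE; apply.
Qed.

Lemma SCP_leP (p q : cond_SCP W1 W2) : end_extends_SCP p q <->
  c_top q <= c_top p /\ forall a, a <= c_top q ->
    (c_z q a, c_f q a) = (c_z p a, c_f p a).
Proof.
split=> -[qp h]; split=> // a aq; first by have [-> ->] := h a aq.
by have [-> ->] := h a aq.
Qed.

Lemma SCPm_leP (p q : cond_SCPm W1 W2) : end_extends_SCPm p q <->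
  cm_top q <= cm_top p /\ forall a, a <= cm_top q ->
    (cm_z q a, tt) = (cm_z p a, tt).
Proof.
split=> -[qp h]; split=> // a aq; first by rewrite (h a aq).
by have [] := h a aq.
Qed.

Lemma SCP_valid (k : cond_SCP W1 W2) :
  valid (@id W1) (c_top k) (fun a => (c_z k a, c_f k a)).
Proof.
split=> [|a _ nSa|a ak Sa|b Sb bk] /=.
- exact: c_top_S20.
- by apply: c_z_dom => -[].
- exact: c_z_cofinal.
- exact/clocked_club_id/c_club.
Qed.

Lemma SCPm_valid (k : cond_SCPm W1 W2) :
  valid (fun _ : W1 => tt) (cm_top k) (fun a => (cm_z k a, tt)).
Proof.
split=> [|a _ nSa|a ak Sa|b Sb bk] /=.
- exact: cm_top_S20.
- by apply: cm_z_dom => -[].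
- exact: cm_z_cofinal.
- exact/clocked_club_unit/cm_club.
Qed.

Lemma SCP_mk (s : W2) (v : W2 -> set W2 * W1) : valid (@id W1) s v ->
  exists k : cond_SCP W1 W2, c_top k = s /\
    forall a, a <= s -> (c_z k a, c_f k a) = v a.
Proof.
have [wo1 _ _] := hW1; have [o o_least] := least_exists wo1 (omega1_inh hW1).
move=> [Ss v0 vc vb].
(* Beyond the top [v] is arbitrary, while a condition must take the default values there. *)
pose z a := if `[< S20 a /\ a <= s >] then (v a).1 else set0.
pose f a := if a <= s then (v a).2 else o.
have zfE a : a <= s -> (z a, f a) = v a.
  move=> as_; rewrite /z /f as_ [RHS]surjective_pairing; congr pair.
  by case: asboolP => // nSa; rewrite v0 // => Sa; case: nSa.
have z_dom a : ~ (S20 a /\ a <= s) -> z a = set0 by rewrite /z; case: asboolP.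
have f_dom a : ~ (a <= s) -> forall x, f a <= x.
  by rewrite /f; case: ifP.
have z_cof a : S20 a -> a <= s -> countable_cofinal (z a) a.
  by move=> Sa as_; rewrite /z; case: asboolP => [_|[]//]; exact: vc.
have club b : S21 W1 b -> b < s ->
    exists2 C, climbing_club W1 z b C & counts_club f C.
  move=> Sb bs; apply/clocked_club_id.
  apply: (@club_at_ext _ _ _ _ _ id v (fun a => (z a, f a))); last exact: vb.
  by move=> a ab; rewrite zfE // ltW // (lt_trans ab).
by exists (CondSCP Ss z_dom f_dom z_cof club).
Qed.

Lemma SCPm_mk (s : W2) (v : W2 -> set W2 * unit) : valid (fun _ : W1 => tt) s v ->
  exists k : cond_SCPm W1 W2, cm_top k = s /\
    forall a, a <= s -> (cm_z k a, tt) = v a.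
Proof.
move=> [Ss v0 vc vb].
pose z a := if `[< S20 a /\ a <= s >] then (v a).1 else set0.
have zfE a : a <= s -> (z a, tt) = v a.
  move=> as_; rewrite /z [RHS]surjective_pairing; congr pair; last by case: (v a).2.
  by case: asboolP => // nSa; rewrite v0 // => Sa; case: nSa.
have z_dom a : ~ (S20 a /\ a <= s) -> z a = set0 by rewrite /z; case: asboolP.
have z_cof a : S20 a -> a <= s -> countable_cofinal (z a) a.
  by move=> Sa as_; rewrite /z; case: asboolP => [_|[]//]; exact: vc.
have club b : S21 W1 b -> b < s -> exists C, climbing_club W1 z b C.
  move=> Sb bs; apply/(clocked_club_unit _ (fun=> tt)).
  apply: (@club_at_ext _ _ _ _ _ (fun=> tt) v (fun a => (z a, tt))); last exact: vb.
  by move=> a ab; rewrite zfE // ltW // (lt_trans ab).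
by exists (CondSCPm Ss z_dom z_cof club).
Qed.

End Instances.

Theorem theorem4p6 (d1 d2 : Order.disp_t)
    (W1 : orderType d1) (W2 : orderType d2)
    (hW1 : is_omega1 W1) (hW2 : is_omega2 W1 W2) :
  [<-> SCP W1 W2;
       forall P : poset, separative P ->
         star_operationally_closed P W1 -> strategically_closed P W2;
       strategically_closed (P_SCP W1 W2) W2;
       forall P : poset, separative P ->
         star_operationally_closed P W1 -> MA P W2;
       MA (P_SCP W1 W2) W2]
  /\
  [<-> SCPm W1 W2;
       forall P : poset, separative P ->
         star_tactically_closed P W1 -> strategically_closed P W2;
       strategically_closed (P_SCPm W1 W2) W2;
       forall P : poset, separative P ->
         star_tactically_closed P W1 -> MA P W2;
       MA (P_SCPm W1 W2) W2].
Proof.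
split.
  exact: (clocked_equivalence hW1 hW2 (@end_extends_SCP_refl _ _ W1 W2)
    (@end_extends_SCP_trans _ _ W1 W2) SCP_leP (SCP_valid hW1) (SCP_mk hW1)
    (clocked_SCP_id hW1) clocked_closed_id).
exact: (clocked_equivalence hW1 hW2 (@end_extends_SCPm_refl _ _ W1 W2)
  (@end_extends_SCPm_trans _ _ W1 W2) SCPm_leP SCPm_valid SCPm_mk
  clocked_SCP_unit clocked_closed_unit).
Qed.
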